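(* Consider a sunflower graph of systems $P_1,P_2,\dots,P_N\in\mathcal{RH}_\infty^{m\times m}$, with central loop $1$. The graph is stable if there exist functions $\xi_k(\omega)\in\mathbb{R}$, $k=1,2,\dots,N$, and $\eta_i(\omega)\in\mathbb{R}$, $i\in\mathcal{V}_1$, such that for every hub $i\in\mathcal{V}_{\text{hub}}$ the sum $\theta_i(\omega)=\sum_{k\in\mathcal{V}_q}\xi_k(\omega)$ is the same for all $q\in\mathcal{Q}_i$, and such that for all $\omega\in[0,\infty]$, $$[-\infty,-1]\cap\mathcal{W}_i(j\omega)=\emptyset,\qquad i\in\mathcal{V}_{\text{hub}},$$ $$[-\infty,-1]\cap\prod_{i\in\mathcal{V}_1\setminus\mathcal{V}_{\text{hub}}}\mathrm{SRG}_{\eta_i(\omega)}(\mathcal{P}_i(j\omega))\prod_{i\in\mathcal{V}_{\text{hub}}}\widetilde{\mathcal{W}}_i(j\omega)=\emptyset,$$ where $\mathcal{P}_i(j\omega)$, $i=1,\dots,N$, is an admissible over-approximation of $P_i(j\omega)$ with respect to $(\xi_k(\omega),\eta_i(\omega))$, and $$\mathcal{W}_i(j\omega)=\sum_{q\in\mathcal{Q}_i}\mathcal{H}^{\text{chord}}_{\theta_i(\omega)}\Big(\prod_{k\in\mathcal{V}_q}\mathrm{SRG}_{\xi_k(\omega)}(\mathcal{P}_k(j\omega))\Big),\quad i\in\mathcal{V}_{\text{hub}},$$ $$\widetilde{\mathcal{W}}_i(j\omega)=\mathcal{H}^{\text{arc}}_{\eta_i(\omega)-\theta_i(\omega)}\left(\frac{\mathrm{SRG}_{\eta_i(\omega)}(\mathcal{P}_i(j\omega))}{[1,e^{2j\theta_i(\omega)}]+\mathcal{W}_i(j\omega)}\right),\quad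 i\in\mathcal{V}_{\text{hub}}.$$
   Context: **Graphs.** Let $\mathbb{G}=(\mathcal{V},\mathcal{E})$ be a directed graph with $\mathcal{V}=\{1,\dots,N\}$. A loop is a path (sequence of edges connecting a sequence of vertices) with equal starting and ending vertices; it is simple if no other vertices repeat. $\mathbb{G}$ is a cactus graph if it is strongly connected and each pair of distinct simple loops has at most one common vertex. Let $l$ be the number of simple loops, $n_q$ the length of loop $q$, and $\mathcal{V}_q$ the set of vertices traversed by loop $q$. A cactus graph is a sunflower graph if one of its simple loops (the central loop, labelled loop $1$) intersects all other loops (the petal loops); the pairwise intersections of loops, called hubs, are contained in the central loop. $\mathcal{V}_{\text{hub}}\subset\mathcal{V}_1$ is the set of hubs shared with petal loops, and for $i\in\mathcal{V}_{\text{hub}}$, $\mathcal{Q}_i$ is the index set of the petal loops containing vertex $i$. **Systems and stability.** $\mathcal{RH}_\infty^{m\times m}$ is the set of $m\times m$ real rational proper stable transfer matrices. Vertex $i$ carries $P_i\in\mathcal{RH}_\infty^{m\times m}$. The interconnection is described by a signed adjacency matrix $A=(a_{ij})\in\mathbb{R}^{N\times N}$ with $a_{ij}\in\{1,-1\}$ if there is a directed edge from vertex $j$ to vertex $i$ and $a_{ij}=0$ otherwise; exactly one edge in each simple loop has sign $-1$ and all its other edges have sign $1$. With $\widetilde P=\mathrm{diag}\{P_1,\dots,P_N\}$, the graph (network) is stable if $\left(I+(-A\otimes I)\widetilde P\right)^{-1}\in\mathcal{RH}_\infty^{Nm\times Nm}$. **SRG notions.** $j$ as a scalar in exponents or $j\omega$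 is the imaginary unit, $\langle x,y\rangle=x^Hy$, $\|\cdot\|$ the Euclidean norm. For $x,y\in\mathbb{C}^m$, $\theta\in\mathbb{R}$, $\angle_\theta(x,y)\in[0,\pi]$ is $\arccos\frac{\mathrm{Re}\langle x,e^{-j\theta}y\rangle}{\|x\|\|y\|}$ if $x\neq0,y\neq0$, and $0$ otherwise. For $C\in\mathbb{C}^{m\times m}$, $$\mathrm{SRG}_\theta(C)=\Big\{\tfrac{\|Cx\|}{\|x\|}\exp\{j(\theta\pm\angle_\theta(x,Cx))\}:0\neq x\in\mathbb{C}^m\Big\}$$ (both signs included); for a matrix set, $\mathrm{SRG}_\theta(\mathcal{C})=\bigcup_{C\in\mathcal{C}}\mathrm{SRG}_\theta(C)$. $\mathrm{Chord}_\theta(z)$ is the closed line segment joining $z$ and $\overline{z}e^{2j\theta}$. Writing $z=|z|e^{j(\theta\pm\psi)}$, $\psi\in[0,\pi]$, $\mathrm{Arc}^+_\theta(z)=\{|z|e^{j(\theta+\varphi)}:|\varphi|\le\psi\}$ and $\mathrm{Arc}^-_\theta(z)=\{|z|e^{j(\theta+\varphi)}:\psi\le|\varphi|\le\pi\}$. A matrix set $\mathcal{C}$ satisfies the $\theta$-arc property if either $\mathrm{Arc}^+_\theta(z)\subset\mathrm{SRG}_\theta(\mathcal{C})$ for all $z\in\mathrm{SRG}_\theta(\mathcal{C})$, or $\mathrm{Arc}^-_\theta(z)\subset\mathrm{SRG}_\theta(\mathcal{C})$ for all $z\in\mathrm{SRG}_\theta(\mathcal{C})$. For $\mathcal{R}\subset\mathbb{C}$,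 $\mathcal{H}^{\text{chord}}_\theta(\mathcal{R})=\bigcup_{z\in\mathcal{R}}\mathrm{Chord}_\theta(z)$ and $\mathcal{H}^{\text{arc}}_\theta(\mathcal{R})=\bigcup_{z\in\mathcal{R}}\mathrm{Arc}^+_\theta(z)$. **Admissible over-approximation.** Given $\xi_k(\omega)$, $k=1,\dots,N$, and $\eta_i(\omega)$, $i\in\mathcal{V}_1$, matrix sets $\mathcal{P}_i(j\omega)\ni P_i(j\omega)$, $i=1,\dots,N$, are admissible over-approximations of $P_i(j\omega)$ with respect to $(\xi_k(\omega),\eta_i(\omega))$ if: (a) for each petal loop $q\in\mathcal{Q}_i$ with $i\in\mathcal{V}_{\text{hub}}$, at least $n_q-1$ of the matrix sets $\{\mathcal{P}_k(j\omega):k\in\mathcal{V}_q\}$ satisfy the $\xi_k(\omega)$-arc property; (b) $\mathcal{P}_i(j\omega)$ satisfies the $\eta_i(\omega)$-arc property for all hubs $i\in\mathcal{V}_{\text{hub}}$ and for all but at most one non-hub $i\in\mathcal{V}_1\setminus\mathcal{V}_{\text{hub}}$. **Set operations.** Sums and products of subsets of $\mathbb{C}$ are elementwise, and the quotient is $\frac{\mathcal{A}}{\mathcal{B}}=\{a/b:a\in\mathcal{A},\,b\in\mathcal{B},\,b\neq0\}$. $[1,e^{2j\theta}]$ is the closed line segment in $\mathbb{C}$ joining $1$ and $e^{2j\theta}$, and $[-\infty,-1]$ is the (extended) real half-line of numbers $\le-1$. The value of a transfer matrix at $\omega=\infty$ is its limit at infinity. *)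

(* Defs.v *)
From HB Require Import structures.
From mathcomp Require Import all_boot all_order all_algebra.
From mathcomp Require Import fraction.
From mathcomp Require Import complex mxtens.
From mathcomp Require Import all_classical all_reals all_analysis.

Set Implicit Arguments.
Unset Strict Implicit.
Unset Printing Implicit Defensive.

Import Order.TTheory GRing.Theory Num.Theory.
Import numFieldNormedType.Exports.

Local Open Scope ring_scope.
Local Open Scope complex_scope.

Section Graphs.
Variable T : finType.
Implicit Types (e : rel T) (s t : seq T).

(* [e x y] means that there is an edge from x to y.  A simple loop is given by
   the list of its vertices in order of traversal, hence only up to rotation;
   a self-loop is a simple loop of length 1. *)
Definition simple_loop e s : bool := (s != [::]) && ucycleb e s.

Definition same_loop s t : Prop := exists n : nat, t = rot n s.

Definition cactus e : Prop :=
  (forall x y : T, connect e x y) /\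
  (forall s t, simple_loop e s -> simple_loop e t -> ~ same_loop s t ->
     (#|[set x in s] :&: [set x in t]| <= 1)%N).

(* [loop] lists every simple loop of the graph exactly once. *)
Definition loop_enumeration e l (loop : 'I_l -> seq T) : Prop :=
  [/\ forall q, simple_loop e (loop q),
      forall p q, same_loop (loop p) (loop q) -> p = q
    & forall s, simple_loop e s -> exists q, same_loop (loop q) s].

Definition loop_vertices l (loop : 'I_l -> seq T) (q : 'I_l) : {set T} :=
  [set x in loop q].

(* The central loop is the one of index [ord0]. *)
Definition sunflower e l (loop : 'I_l.+1 -> seq T) : Prop :=
  let V := loop_vertices loop in
  [/\ cactus e, loop_enumeration e loop,
      forall q, q != ord0 -> V ord0 :&: V q != finset.set0
    & forall p q, p != q -> V p :&: V q \subset V ord0].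

Definition hubs l (loop : 'I_l.+1 -> seq T) : {set T} :=
  [set i in loop_vertices loop ord0 |
     [exists q, (q != ord0) && (i \in loop_vertices loop q)]].

Definition petals_at l (loop : 'I_l.+1 -> seq T) (i : T) : {set 'I_l.+1} :=
  [set q | (q != ord0) && (i \in loop_vertices loop q)].

End Graphs.

Section Systems.
Variable R : realType.
Local Notation C := R[i].
Local Notation ratfun := {fraction {poly R}}.

(* Lowest terms representative of [f], up to a common constant factor. *)
Definition rat_num (f : ratfun) : {poly R} :=
  let: (a, b) := frac (repr f) in a %/ gcdp a b.
Definition rat_den (f : ratfun) : {poly R} :=
  let: (a, b) := frac (repr f) in b %/ gcdp a b.

Definition polyval (p : {poly R}) (s : C) : C := (map_poly (real_complex R) p).[s].

Definition ratval (f : ratfun) (s : C) : C :=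
  polyval (rat_num f) s / polyval (rat_den f) s.

Definition proper (f : ratfun) : Prop := (size (rat_num f) <= size (rat_den f))%N.

(* The poles of [f] are the complex roots of [rat_den f]. *)
Definition stable (f : ratfun) : Prop :=
  forall s : C, polyval (rat_den f) s = 0 -> complex.Re s < 0.

Definition RHinf p q (F : 'M[ratfun]_(p, q)) : Prop :=
  forall i j, proper (F i j) /\ stable (F i j).

(* Value at jw for w in [0, +oo]; the value at w = -oo is irrelevant. *)
Definition freqval (f : ratfun) (w : \bar R) : C :=
  match w with
  | r%:E => ratval f (0 +i* r)
  | +oo%E => lim ((fun r : R => (ratval f (0 +i* r) : C^o)) @ +oo)%classic
  | -oo%E => 0
  end.

Definition freqresp p q (F : 'M[ratfun]_(p, q)) (w : \bar R) : 'M[C]_(p, q) :=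
  map_mx (fun f => freqval f w) F.

(* The entry A i j belongs to the edge from j to i; [next s x] is the successor
   of x on the loop s. *)
Definition signed_adjacency N (e : rel 'I_N) (A : 'M[R]_N) : Prop :=
  [/\ forall i j, e j i -> A i j = 1 \/ A i j = -1,
      forall i j, ~~ e j i -> A i j = 0
    & forall s, simple_loop e s -> #|[set x in s | A (next s x) x == -1]| = 1%N].

Definition return_difference N m (A : 'M[R]_N) (P : 'I_N -> 'M[ratfun]_m)
    : 'M[ratfun]_(N * m) :=
  let Aconst := map_mx (fun a : R => FracField.tofrac a%:P) A in
  let Pdiag := \sum_(i < N) tensmx (delta_mx i i) (P i) in
  1%:M + tensmx (- Aconst) (1%:M : 'M[ratfun]_m) *m Pdiag.

Definition network_stable N m (A : 'M[R]_N) (P : 'I_N -> 'M[ratfun]_m) : Prop :=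
  return_difference A P \in unitmx /\ RHinf (invmx (return_difference A P)).

End Systems.

Local Open Scope classical_set_scope.

Section ScaledRelativeGraphs.
Variable R : realType.
Local Notation C := R[i].

Definition cis (t : R) : C := cos t +i* sin t.

Definition segment (a b : C) : set C :=
  [set z | exists t : R, 0 <= t <= 1 /\ z = (1 - t)%:C * a + t%:C * b].

Section Matrices.
Variable m : nat.
Implicit Types (x y : 'cV[C]_m) (M : 'M[C]_m) (MM : set 'M[C]_m) (th : R).

Definition inner x y : C := \sum_(k < m) conjc (x k ord0) * y k ord0.

Definition enorm x : R := Num.sqrt (complex.Re (inner x x)).

Definition angle th x y : R :=
  if (x != 0) && (y != 0) then
    acos (complex.Re (inner x (cis (- th) *: y)) / (enorm x * enorm y))
  else 0.

Definition SRG th M : set C :=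
  [set z | exists x, x != 0 /\
     let rho := (enorm (M *m x) / enorm x)%:C in
     let psi := angle th x (M *m x) in
     z = rho * cis (th + psi) \/ z = rho * cis (th - psi)].

Definition SRGset th MM : set C := \bigcup_(M in MM) SRG th M.

End Matrices.

Definition chord (th : R) (z : C) : set C := segment z (conjc z * cis (2 * th)).

(* [polar_at th z psi]: psi in [0, pi] and z = |z| e^(j (th +- psi)).  For z <> 0
   this determines psi; for z = 0 both arcs below are {0}. *)
Definition polar_at (th : R) (z : C) (psi : R) : Prop :=
  0 <= psi <= pi /\
  (z = (Normc.normc z)%:C * cis (th + psi) \/ z = (Normc.normc z)%:C * cis (th - psi)).

Definition arc_plus (th : R) (z : C) : set C :=
  [set w | exists psi phi : R, [/\ polar_at th z psi, `|phi| <= psi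
     & w = (Normc.normc z)%:C * cis (th + phi)]].

Definition arc_minus (th : R) (z : C) : set C :=
  [set w | exists psi phi : R, [/\ polar_at th z psi, psi <= `|phi| <= pi
     & w = (Normc.normc z)%:C * cis (th + phi)]].

Definition arc_property m (th : R) (MM : set 'M[C]_m) : Prop :=
  (forall z, SRGset th MM z -> arc_plus th z `<=` SRGset th MM) \/
  (forall z, SRGset th MM z -> arc_minus th z `<=` SRGset th MM).

Definition chord_hull (th : R) (S : set C) : set C := \bigcup_(z in S) chord th z.
Definition arc_hull (th : R) (S : set C) : set C := \bigcup_(z in S) arc_plus th z.

Definition set_add (S T : set C) : set C := [set a + b | a in S & b in T].
Definition set_mul (S T : set C) : set C := [set a * b | a in S & b in T].
Definition set_div (S T : set C) : set C :=
  [set z | exists a b, [/\ S a, T b, b != 0 & z = a / b]].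

Definition set_sum (I : finType) (J : {set I}) (S : I -> set C) : set C :=
  [set z | exists f : I -> C,
     (forall i, i \in J -> S i (f i)) /\ z = \sum_(i in J) f i].
Definition set_prod (I : finType) (J : {set I}) (S : I -> set C) : set C :=
  [set z | exists f : I -> C,
     (forall i, i \in J -> S i (f i)) /\ z = \prod_(i in J) f i].

(* Only the finite part of the half-line [-oo, -1] matters, as it is intersected
   with subsets of the complex plane. *)
Definition half_line : set C := [set z | exists r : R, r <= -1 /\ z = r%:C].

End ScaledRelativeGraphs.

Section Conditions.
Variables (R : realType) (N m l : nat) (loop : 'I_l.+1 -> seq 'I_N).
Local Notation C := R[i].
Local Notation V := (loop_vertices loop).
Local Notation Vhub := (hubs loop).
Local Notation Q := (petals_at loop).

(* At one fixed frequency: [M] is the frequency response of the vertices,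
   [MM] the matrix sets. *)
Definition admissible (xi eta : 'I_N -> R) (M : 'I_N -> 'M[C]_m)
    (MM : 'I_N -> set 'M[C]_m) : Prop :=
  [/\ forall i, MM i (M i),
      forall i, i \in Vhub -> forall q, q \in Q i ->
        exists K : {set 'I_N}, [/\ K \subset V q, (size (loop q) - 1 <= #|K|)%N
          & forall k, k \in K -> arc_property (xi k) (MM k)],
      forall i, i \in Vhub -> arc_property (eta i) (MM i)
    & exists E : {set 'I_N}, (#|E| <= 1)%N /\
        forall i, i \in V ord0 :\: Vhub -> i \notin E ->
          arc_property (eta i) (MM i)].

Definition petal_region (xi theta : 'I_N -> R) (MM : 'I_N -> set 'M[C]_m)
    (i : 'I_N) : set C :=
  set_sum (Q i) (fun q =>
    chord_hull (theta i) (set_prod (V q) (fun k => SRGset (xi k) (MM k)))).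

Definition hub_region (xi eta theta : 'I_N -> R) (MM : 'I_N -> set 'M[C]_m)
    (i : 'I_N) : set C :=
  arc_hull (eta i - theta i)
    (set_div (SRGset (eta i) (MM i))
       (set_add (segment 1 (cis (2 * theta i))) (petal_region xi theta MM i))).

Definition central_region (xi eta theta : 'I_N -> R)
    (MM : 'I_N -> set 'M[C]_m) : set C :=
  set_mul (set_prod (V ord0 :\: Vhub) (fun i => SRGset (eta i) (MM i)))
          (set_prod Vhub (hub_region xi eta theta MM)).

End Conditions.

(* Main.v *)
(* At a fixed frequency, a solution of the loop equations is followed along the
   loops.  If [y = M x], the scaled relative graph of [M] contains the numbers
   [|y|/|x| * exp (j (theta +- angle_theta (x, y)))].  The spherical triangle
   inequality shows that this property passes to compositions [M2 M1] and to
   products of regions as soon as one of the two factors has the arc property;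
   chord hulls make it pass to the sums of the petals at a hub, and the quotient
   by [1 + petals] describes the hub as a single factor of the central loop.  A
   nonzero solution would therefore put a point of the half-line into a region.
   The same holds when the negative edges of the petals, and then the one of the
   central loop, are scaled by a factor in [0, 1].  Hence, along this homotopy
   from an acyclic network, the determinant of the return difference, multiplied
   by a power of a common denominator, is a real polynomial of constant degree
   without imaginary roots, and it stays Hurwitz. *)
Require Import Defs.
From mathcomp Require Import all_boot all_order all_algebra.
From mathcomp Require Import perm fraction.
From mathcomp Require Import complex mxtens.
From mathcomp Require Import all_classical all_reals all_analysis.
From mathcomp Require Import zify ring lra.

Set Implicit Arguments.
Unset Strict Implicit.
Unset Printing Implicit Defensive.

Import Order.TTheory GRing.Theory Num.Theory.
Import numFieldNormedType.Exports.

Local Open Scope classical_set_scope.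
Local Open Scope ring_scope.
Local Open Scope complex_scope.

(** * The real inner product of complex vectors *)

Section Geometry.
Variables (R : realType) (m : nat).
Local Notation C := R[i].
Implicit Types (x y z : 'cV[C]_m) (th t : R).

(** The homotopy needs two stages. The hub regions are built from petals at full strength, so the
    central condition says nothing about hubs whose petals are scaled. The petals are therefore
    closed while the central loop is cut ([tau = 0]), where the hub conditions suffice, and the
    central loop is closed afterwards with [sigma = 1]. Scaling by a nonzero factor [t <= 1] is
    harmless because the half-line contains every [-1/t].

    Angles are handled through their cosines: the spherical triangle inequality becomes a Gram
    determinant inequality, and no sum of arccosines has to be reduced modulo 2 pi. Chords and arcs
    serve different purposes: chord regions can be added, while a product needs arcs on one side;
    hence each hub quotient receives an arc hull before it enters the central product.

    The frequency +oo is what keeps the degree constant: the response there is a ratio of top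
    coefficients, and its trivial kernel says that the top coefficient of the determinant does not
    vanish. *)

Definition rin x y : R := complex.Re (inner x y).

Lemma rinE x y : rin x y = \sum_(k < m)
  (complex.Re (x k ord0) * complex.Re (y k ord0) +
   complex.Im (x k ord0) * complex.Im (y k ord0)).
Proof.
rewrite /rin /inner (raddf_sum (@complex.Re R : Rcomplex R -> R)) /=.
by apply: eq_bigr => k _; case: (x k ord0) => a b; case: (y k ord0) => c d /=; ring.
Qed.

Lemma rinC x y : rin x y = rin y x.
Proof.
rewrite !rinE; apply: eq_bigr => k _.
by rewrite ![_ * complex.Re (x _ _)]mulrC ![_ * complex.Im (x _ _)]mulrC.
Qed.

Lemma rinDr x y z : rin x (y + z) = rin x y + rin x z.
Proof.
rewrite !rinE -big_split /=; apply: eq_bigr => k _; rewrite !mxE.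
by case: (x k ord0) => a b; case: (y k ord0) => c d; case: (z k ord0) => c' d' /=; ring.
Qed.

Lemma rinZr x y t : rin x (t%:C *: y) = t * rin x y.
Proof.
rewrite !rinE mulr_sumr /=; apply: eq_bigr => k _; rewrite !mxE.
by case: (x k ord0) => a b; case: (y k ord0) => c d /=; ring.
Qed.

Lemma rinDl x y z : rin (y + z) x = rin y x + rin z x.
Proof. by rewrite !(rinC _ x) rinDr. Qed.

Lemma rinZl x y t : rin (t%:C *: y) x = t * rin y x.
Proof. by rewrite !(rinC _ x) rinZr. Qed.

Lemma rinNr x y : rin x (- y) = - rin x y.
Proof.
rewrite !rinE -sumrN; apply: eq_bigr => k _; rewrite !mxE.
by case: (x k ord0) => a b; case: (y k ord0) => c d /=; ring.
Qed.

Lemma rin0r x : rin x 0 = 0.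
Proof. by rewrite rinE big1// => k _; rewrite mxE /= !mulr0 addr0. Qed.

Lemma rinNl x y : rin (- x) y = - rin x y.
Proof. by rewrite rinC rinNr rinC. Qed.

Lemma cis_sqr th : (cos th) ^+ 2 + (sin th) ^+ 2 = 1 :> R.
Proof. exact: cos2Dsin2. Qed.

Lemma rin_cis th x y : rin (cis th *: x) (cis th *: y) = rin x y.
Proof.
rewrite !rinE; apply: eq_bigr => k _; rewrite !mxE.
have := cis_sqr th; rewrite /cis; move: (cos th) (sin th) => p q.
case: (x k ord0) => a b; case: (y k ord0) => c d /= E.
by transitivity ((p ^+ 2 + q ^+ 2) * (a * c + b * d)); [ring | rewrite E mul1r].
Qed.

Lemma rin_cisl th x : rin x (cis th *: x) = cos th * rin x x.
Proof.
rewrite !rinE mulr_sumr; apply: eq_bigr => k _; rewrite !mxE /cis.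
by case: (x k ord0) => a b /=; ring.
Qed.

Lemma rin_ge0 x : 0 <= rin x x.
Proof. by rewrite rinE sumr_ge0// => k _; rewrite -!expr2 addr_ge0 ?sqr_ge0. Qed.

Lemma rin_eq0 x : (rin x x == 0) = (x == 0).
Proof.
apply/eqP/eqP => [|->]; last by rewrite rinE big1// => k _; rewrite mxE /= !mul0r addr0.
rewrite rinE => /eqP; rewrite psumr_eq0; last first.
  by move=> k _; rewrite -!expr2 addr_ge0 ?sqr_ge0.
move=> /allP H; apply/matrixP => i j; rewrite (ord1 j) mxE.
have := H i (mem_index_enum _); rewrite /= -!expr2 paddr_eq0 ?sqr_ge0// !sqrf_eq0.
by case: (x i ord0) => a b /= /andP[/eqP-> /eqP->].
Qed.

Lemma rin_gt0 x : (0 < rin x x) = (x != 0).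
Proof. by rewrite lt_def rin_eq0 rin_ge0 andbT. Qed.

Lemma enorm_sqr x : enorm x ^+ 2 = rin x x.
Proof. by rewrite /enorm -/(rin x x) sqr_sqrtr// rin_ge0. Qed.

Lemma enorm_ge0 x : 0 <= enorm x.
Proof. exact: sqrtr_ge0. Qed.

Lemma enorm_eq0 x : (enorm x == 0) = (x == 0).
Proof. by rewrite -rin_eq0 -enorm_sqr sqrf_eq0. Qed.

Lemma enorm_gt0 x : (0 < enorm x) = (x != 0).
Proof. by rewrite lt_def enorm_eq0 enorm_ge0 andbT. Qed.

Lemma enorm_cis th x : enorm (cis th *: x) = enorm x.
Proof. by rewrite /enorm -!/(rin _ _) rin_cis. Qed.

Lemma cauchy_schwarz x y : rin x y ^+ 2 <= rin x x * rin y y.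
Proof.
have [->|y0] := eqVneq y 0.
  by rewrite !rin0r mulr0 expr0n.
have yy : 0 < rin y y by rewrite rin_gt0.
have := rin_ge0 ((rin y y)%:C *: x + (- rin x y)%:C *: y).
rewrite !(rinDl, rinDr, rinZl, rinZr) (rinC y x).
move: yy; move: (rin y y) (rin x x) (rin x y) => a b c a0 H.
have {}H : 0 <= a * (b * a - c ^+ 2).
  by apply: le_trans H _; rewrite le_eqVlt; apply/orP; left; apply/eqP; ring.
by move: H; rewrite pmulr_rge0// subr_ge0.
Qed.

Lemma enorm_triangle x y : enorm (x + y) <= enorm x + enorm y.
Proof.
rewrite -(@ler_pXn2r _ 2)// ?nnegrE ?addr_ge0 ?enorm_ge0//.
rewrite enorm_sqr !(rinDl, rinDr) (rinC y x) sqrrD !enorm_sqr.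
have := cauchy_schwarz x y; rewrite -!enorm_sqr -exprMn => H.
have : rin x y <= enorm x * enorm y.
  rewrite (le_trans (ler_norm _))// -(@ler_pXn2r _ 2)// ?nnegrE ?mulr_ge0 ?enorm_ge0//.
  by rewrite real_normK ?num_real.
lra.
Qed.

(** Cauchy-Schwarz for the components of [x] and [z] orthogonal to [y], cleared of denominators; it
    expresses that the Gram determinant of the three vectors is nonnegative. *)
Lemma gram_det x y z :
  (rin y y * rin x z - rin x y * rin y z) ^+ 2 <=
  (rin x x * rin y y - rin x y ^+ 2) * (rin y y * rin z z - rin y z ^+ 2).
Proof.
have [->|y0] := eqVneq y 0.
  rewrite (rinC 0) !rin0r; lra.
have yy : 0 < rin y y by rewrite rin_gt0.
have := cauchy_schwarz ((rin y y)%:C *: x + (- rin x y)%:C *: y)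
                       ((rin y y)%:C *: z + (- rin y z)%:C *: y).
rewrite !(rinDl, rinDr, rinZl, rinZr) (rinC y x) (rinC z y).
move: yy; move: (rin y y) (rin x x) (rin x y) (rin y z) (rin z z) (rin x z).
move=> a b c d e f a0 H.
rewrite -(@ler_pM2l _ (a ^+ 2)) ?exprn_gt0//.
by apply: le_trans (le_trans _ H) _; rewrite le_eqVlt; apply/orP; left; apply/eqP; ring.
Qed.

End Geometry.

(** * Regions covering the gain and phase of a matrix *)

Section Cis.
Variable R : realType.
Local Notation C := R[i].
Implicit Types (t a b c d : R).

Lemma cisD t u : cis (t + u) = cis t * cis u :> C.
Proof. by rewrite /cis cosD sinD; simpc; congr (_ +i* _); rewrite addrC. Qed.

Lemma cis0 : cis 0 = 1 :> C.
Proof. by rewrite /cis cos0 sin0. Qed.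

Lemma cisNK t : cis t * cis (- t) = 1 :> C.
Proof. by rewrite -cisD subrr cis0. Qed.

Lemma normc_cis t : Normc.normc (cis t) = 1 :> R.
Proof. by rewrite /= cos2Dsin2 sqrtr1. Qed.

Lemma normc_real (r : R) : 0 <= r -> Normc.normc r%:C = r.
Proof. by move=> r0; rewrite /= expr0n addr0 sqrtr_sqr ger0_norm. Qed.

Lemma unit_cis a b : a ^+ 2 + b ^+ 2 = 1 ->
  exists phi, [/\ `|phi| = acos a, -1 <= a <= 1 & a +i* b = cis phi].
Proof.
move=> ab; have a1 : -1 <= a <= 1.
  by rewrite -ler_norml -(@ler_pXn2r _ 2)// ?nnegrE// expr1n real_normK ?num_real//; nra.
have s2 : (sin (acos a)) ^+ 2 = b ^+ 2.
  have := cos2Dsin2 (acos a); rewrite acosK//; lra.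
have s0 := acos_ge0 a1.
move/eqP: s2; rewrite eqf_sqr => /orP[]/eqP sb.
  by exists (acos a); rewrite ger0_norm// /cis acosK// sb.
by exists (- acos a); rewrite normrN ger0_norm// /cis cosN sinN acosK// sb opprK.
Qed.

(* The spherical triangle inequality in terms of cosines: if [A], [D] and [a]
   are the cosines of the sides of a spherical triangle, the rotation by the
   angle of cosine [a] factors through one of the two rotations of cosine [A],
   and the choice of its sign makes the other factor shorter, resp. longer,
   than the side of cosine [D]. *)
Lemma rotation_split a b A D (shorter : bool) : a ^+ 2 + b ^+ 2 = 1 -> A ^+ 2 <= 1 ->
  (a - A * D) ^+ 2 <= (1 - A ^+ 2) * (1 - D ^+ 2) ->
  exists b1 a2 b2, [/\ A ^+ 2 + b1 ^+ 2 = 1, a2 ^+ 2 + b2 ^+ 2 = 1,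
    a +i* b = (A +i* b1) * (a2 +i* b2) & if shorter then D <= a2 else a2 <= D].
Proof.
move=> ab A1 gram.
have [s [s0 s2]] : exists s, 0 <= s /\ s ^+ 2 = 1 - A ^+ 2.
  by exists (Num.sqrt (1 - A ^+ 2)); rewrite sqrtr_ge0 sqr_sqrtr// subr_ge0.
(* The sign of [b1] gives the remaining cosine [a * A + b * b1] one of its extreme values
   [a * A + |b| * s] and [a * A - |b| * s]. *)
have [b1 [b1s bb1]] : exists b1, b1 ^+ 2 = s ^+ 2 /\
    b * b1 = if shorter then `|b| * s else - (`|b| * s).
  have [b0|b0] := ger0P b; case: shorter.
  - by exists s.
  - by exists (- s); split; [ring|ring].
  - by exists (- s); split; [ring|ring].
  - by exists s; split; [ring|ring].
exists b1, (a * A + b * b1), (b * A - a * b1).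
have u1 : A ^+ 2 + b1 ^+ 2 = 1 by rewrite b1s s2; ring.
split=> //.
- by transitivity ((a ^+ 2 + b ^+ 2) * (A ^+ 2 + b1 ^+ 2)); [ring | rewrite ab u1 mulr1].
- simpc; congr (_ +i* _).
    by transitivity (a * (A ^+ 2 + b1 ^+ 2)); [rewrite u1 mulr1 | ring].
  by transitivity (b * (A ^+ 2 + b1 ^+ 2)); [rewrite u1 mulr1 | ring].
(* The Gram inequality is symmetric in the three cosines [a], [A], [D], so it also bounds [D] around
   [a * A]. *)
have H : `|D - a * A| <= `|b| * s.
  rewrite -(@ler_pXn2r _ 2)// ?nnegrE ?mulr_ge0// exprMn !real_normK ?num_real//.
  by rewrite s2; nra.
rewrite bb1; case: shorter {bb1}; move: H; rewrite ler_norml => /andP[]; lra.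
Qed.

End Cis.

Section Covers.
Variables (R : realType) (m : nat).
Local Notation C := R[i].
Implicit Types (S : set C) (x y z : 'cV[C]_m) (th t a b : R) (T M : 'M[C]_m).

Definition polar th x y a b : C := (enorm y / enorm x)%:C * cis th * (a +i* b).

(* [S] contains [|y|/|x| * exp (j (th +- angle th x y))]: the angle is only given
   through its cosine [a], and [b] is either sign of its sine.  When [y = 0], [a]
   and [b] are arbitrary and the condition says that [S] contains [0]. *)
Definition cov S th x y : Prop := forall a b, a ^+ 2 + b ^+ 2 = 1 ->
  a * (enorm x * enorm y) = rin x (cis (- th) *: y) -> S (polar th x y a b).

(** Larger cosines are smaller angles: [plus] is the arc around the direction [th], its negation the
    complementary arc. *)
Definition cov_arc (plus : bool) S th x y : Prop := forall a b, a ^+ 2 + b ^+ 2 = 1 ->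
  (if plus then rin x (cis (- th) *: y) <= a * (enorm x * enorm y)
   else a * (enorm x * enorm y) <= rin x (cis (- th) *: y)) -> S (polar th x y a b).

Definition mcov S th T : Prop := forall x, x != 0 -> cov S th x (T *m x).

Definition marc S th T : Prop :=
  forall x, x != 0 -> exists plus, cov_arc plus S th x (T *m x).

Lemma marc_mcov S th T : marc S th T -> mcov S th T.
Proof.
move=> H x x0 a b ab E; have [p] := H x x0.
by apply=> //; case: p; rewrite E.
Qed.

Lemma enorm0 : enorm (0 : 'cV[C]_m) = 0.
Proof. by apply/eqP; rewrite enorm_eq0. Qed.

Lemma polar_nil th x a b : polar th x 0 a b = 0.
Proof. by rewrite /polar enorm0 mul0r !mul0r. Qed.

Lemma cosine_exists th x y : x != 0 -> y != 0 -> exists a,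
  [/\ a * (enorm x * enorm y) = rin x (cis (- th) *: y), -1 <= a <= 1 & a ^+ 2 <= 1].
Proof.
rewrite -!enorm_gt0 => x0 y0; exists (rin x (cis (- th) *: y) / (enorm x * enorm y)).
have xy0 : enorm x * enorm y != 0 by rewrite mulf_neq0 ?gt_eqF.
have a2 : (rin x (cis (- th) *: y) / (enorm x * enorm y)) ^+ 2 <= 1.
  rewrite expr_div_n ler_pdivrMr ?mul1r ?exprn_gt0 ?mulr_gt0//.
  by rewrite exprMn !enorm_sqr -(rin_cis (- th) y) cauchy_schwarz.
split=> //; first by rewrite divfK.
by rewrite -ler_norml -(@ler_pXn2r _ 2)// ?nnegrE// expr1n real_normK ?num_real.
Qed.

(** When one factor of a product annihilates the signal, the product point is 0 times some element
    of the other region, which must be inhabited. *)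
Lemma cov_nonempty S th x y : x != 0 -> cov S th x y -> exists w, S w.
Proof.
move=> x0; have [->|y0] := eqVneq y 0.
  move=> /(_ 1 0); rewrite expr1n expr0n addr0 => /(_ erefl).
  by rewrite enorm0 !mulr0 scaler0 rin0r => /(_ erefl); exists (polar th x 0 1 0).
have [a [E _ a2]] := cosine_exists th x0 y0.
move=> /(_ a (Num.sqrt (1 - a ^+ 2))); rewrite sqr_sqrtr ?subr_ge0// addrC subrK => /(_ erefl E) H.
by eexists; exact: H.
Qed.

Lemma cov_zero S th x : cov S th x 0 -> S 0.
Proof.
move=> /(_ 1 0); rewrite expr1n expr0n addr0 => /(_ erefl).
by rewrite enorm0 !mulr0 scaler0 rin0r polar_nil => /(_ erefl).
Qed.

(** Rotations are isometries, so [gram_det] for [x] and the rotated [y] and [z] becomes the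
    spherical triangle inequality after division by [|x|^2 |y|^4 |z|^2]. *)
Lemma gram_cosines th1 th2 x y z A D a : x != 0 -> y != 0 -> z != 0 ->
  A * (enorm x * enorm y) = rin x (cis (- th1) *: y) ->
  D * (enorm y * enorm z) = rin y (cis (- th2) *: z) ->
  a * (enorm x * enorm z) = rin x (cis (- (th1 + th2)) *: z) ->
  (a - A * D) ^+ 2 <= (1 - A ^+ 2) * (1 - D ^+ 2).
Proof.
rewrite -!enorm_gt0 => x0 y0 z0 EA ED Ea.
have := gram_det x (cis (- th1) *: y) (cis (- (th1 + th2)) *: z).
rewrite -EA -Ea opprD cisD -scalerA !rin_cis -ED -!enorm_sqr.
move: x0 y0 z0; move: (enorm x) (enorm y) (enorm z) => X Y Z X0 Y0 Z0 H.
have P0 : 0 < X ^+ 2 * Y ^+ 2 * Y ^+ 2 * Z ^+ 2 by rewrite !mulr_gt0 ?exprn_gt0.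
rewrite -(ler_pM2l P0); apply: le_trans (le_trans _ H) _;
  by rewrite le_eqVlt; apply/orP; left; apply/eqP; ring.
Qed.

Lemma polarM th1 th2 x y z a1 b1 a2 b2 a b : y != 0 ->
  a +i* b = (a1 +i* b1) * (a2 +i* b2) ->
  polar (th1 + th2) x z a b = polar th1 x y a1 b1 * polar th2 y z a2 b2.
Proof.
move=> y0 E; rewrite /polar E cisD.
have -> : enorm z / enorm x = (enorm y / enorm x) * (enorm z / enorm y).
  by rewrite mulrC [RHS]mulrC mulrA divfK ?enorm_eq0// mulrC.
rewrite rmorphM /=; by ring.
Qed.

(** The first factor is taken at its true cosine [A]; by [rotation_split] the remaining rotation can
    be placed on the arc of the second factor, whichever type that arc has. *)
Lemma mcov_arc_r S1 S2 th1 th2 T1 T2 : mcov S1 th1 T1 -> marc S2 th2 T2 ->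
  mcov (set_mul S1 S2) (th1 + th2) (T2 *m T1).
Proof.
move=> H1 H2 x x0 a b ab; rewrite -mulmxA.
set y := T1 *m x; set z := T2 *m y => Ea.
have C1 : cov S1 th1 x y by exact: H1.
have [y0|y0] := eqVneq y 0.
  have [w Sw] := cov_nonempty x0 (marc_mcov H2 x0).
  rewrite /z y0 mulmx0 polar_nil; exists 0; first by apply: (@cov_zero _ th1 x); rewrite -y0.
  by exists w => //; rewrite mul0r.
have [p C2] := H2 _ y0; rewrite -/z in C2.
have [z0|z0] := eqVneq z 0.
  have [w Sw] := cov_nonempty x0 C1.
  rewrite z0 polar_nil; exists w => //; exists 0; rewrite ?mulr0//.
  by apply: (@cov_zero _ th2 y); rewrite -z0; apply: marc_mcov.
have [A [EA _ A1]] := cosine_exists th1 x0 y0.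
have [D [ED _ _]] := cosine_exists th2 y0 z0.
have G := gram_cosines x0 y0 z0 EA ED Ea.
have [b1 [a2 [b2 [u1 u2 E h]]]] := rotation_split p ab A1 G.
exists (polar th1 x y A b1); first exact: C1.
exists (polar th2 y z a2 b2); last by rewrite -(polarM _ _ _ _ y0 E).
have yz0 : 0 < enorm y * enorm z by rewrite mulr_gt0// enorm_gt0.
by apply: C2 => //; rewrite -ED; case: p h {G} => /=; rewrite ler_pM2r.
Qed.

Lemma mcov_arc_l S1 S2 th1 th2 T1 T2 : marc S1 th1 T1 -> mcov S2 th2 T2 ->
  mcov (set_mul S1 S2) (th1 + th2) (T2 *m T1).
Proof.
move=> H1 H2 x x0 a b ab; rewrite -mulmxA.
set y := T1 *m x; set z := T2 *m y => Ea.
have [p C1] := H1 _ x0; rewrite -/y in C1.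
have C1' : cov S1 th1 x y by exact: marc_mcov.
have [y0|y0] := eqVneq y 0.
  have [w Sw] := cov_nonempty x0 (H2 _ x0).
  rewrite /z y0 mulmx0 polar_nil; exists 0; first by apply: (@cov_zero _ th1 x); rewrite -y0.
  by exists w => //; rewrite mul0r.
have C2 : cov S2 th2 y z by exact: H2.
have [z0|z0] := eqVneq z 0.
  have [w Sw] := cov_nonempty x0 C1'.
  rewrite z0 polar_nil; exists w => //; exists 0; rewrite ?mulr0//.
  by apply: (@cov_zero _ th2 y); rewrite -z0.
have [A [EA _ _]] := cosine_exists th1 x0 y0.
have [D [ED _ D1]] := cosine_exists th2 y0 z0.
have G := gram_cosines x0 y0 z0 EA ED Ea.
(* Now the second factor keeps its true cosine [D], so the two cosines exchange roles. *)
have {}G : (a - D * A) ^+ 2 <= (1 - D ^+ 2) * (1 - A ^+ 2).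
  by rewrite [D * A]mulrC [_ * (1 - A ^+ 2)]mulrC.
have [b2 [a1 [b1 [u2 u1 E h]]]] := rotation_split p ab D1 G.
rewrite mulrC in E.
exists (polar th1 x y a1 b1); last first.
  by exists (polar th2 y z D b2); [exact: C2 | rewrite -(polarM _ _ _ _ y0 E)].
have xy0 : 0 < enorm x * enorm y by rewrite mulr_gt0// enorm_gt0.
by apply: C1 => //; rewrite -EA; case: p h {G} => /=; rewrite ler_pM2r.
Qed.

End Covers.

(** * Regions of scaled relative graphs, hulls, sums and quotients *)

Section Regions.
Variables (R : realType) (m : nat).
Local Notation C := R[i].
Implicit Types (S : set C) (x y z : 'cV[C]_m) (th t a b : R) (T M : 'M[C]_m).

Lemma mcov_sub S1 S2 th T : S1 `<=` S2 -> mcov S1 th T -> mcov S2 th T.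
Proof. by move=> S12 H x x0 a b ab E; apply: S12; apply: H. Qed.

Lemma polar_cis th x y a b phi : a +i* b = cis phi ->
  polar th x y a b = (enorm y / enorm x)%:C * cis (th + phi).
Proof. by move=> E; rewrite /polar E cisD mulrA. Qed.

Lemma normc_polar th x y a b : a ^+ 2 + b ^+ 2 = 1 ->
  Normc.normc (polar th x y a b) = enorm y / enorm x.
Proof.
move=> /unit_cis[phi [_ _ E]]; rewrite (polar_cis _ _ _ E) Normc.normcM normc_cis mulr1.
by rewrite normc_real// divr_ge0 ?enorm_ge0.
Qed.

Lemma polar_arc (plus : bool) th x y A B a b : A ^+ 2 + B ^+ 2 = 1 -> a ^+ 2 + b ^+ 2 = 1 ->
  (if plus then A <= a else a <= A) ->
  (if plus then arc_plus th (polar th x y A B) (polar th x y a b)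
   else arc_minus th (polar th x y A B) (polar th x y a b)).
Proof.
move=> AB ab h.
have nE := normc_polar th x y AB.
have [psi [psiE A1 AE]] := unit_cis AB; have [phi [phiE a1 aE]] := unit_cis ab.
have P : polar_at th (polar th x y A B) (acos A).
  split; first by rewrite acos_ge0// acos_lepi.
  rewrite nE (polar_cis _ _ _ AE) -psiE; have [_|_] := ger0P psi; first by left.
  by right; rewrite opprK.
have W : polar th x y a b = (Normc.normc (polar th x y A B))%:C * cis (th + phi).
  by rewrite nE (polar_cis _ _ _ aE).
case: plus h => h; exists (acos A), phi; split=> //; rewrite phiE.
  rewrite leNgt; apply/negP => lt; have : cos (acos a) < cos (acos A).
    by rewrite ltr_cos// in_itv/= ?acos_ge0 ?acos_lepi.
  by rewrite !acosK//; lra.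
rewrite acos_lepi// andbT leNgt; apply/negP => lt; have : cos (acos A) < cos (acos a).
  by rewrite ltr_cos// in_itv/= ?acos_ge0 ?acos_lepi.
by rewrite !acosK//; lra.
Qed.

Lemma SRGset_mcov th (MM : set 'M[C]_m) M : MM M -> mcov (SRGset th MM) th M.
Proof.
move=> MMM x x0 a b ab E; exists M => //; exists x; split=> //=.
have [y0|y0] := eqVneq (M *m x) 0.
  by rewrite y0 polar_nil enorm0 mul0r mul0r; left.
rewrite /angle x0 y0 /=; move: E; rewrite -/(rin _ _) => <-.
rewrite mulfK ?mulf_neq0 ?enorm_eq0//.
have [phi [<- _ pE]] := unit_cis ab; rewrite (polar_cis _ _ _ pE).
by have [_|_] := ger0P phi; [left | right; rewrite opprK].
Qed.

(** Two regions serve both a set with the arc property ([S1 = S2]) and the arc hull of an arbitrary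
    set. The point 0 is treated apart because no cosine is determined when [T x = 0]. *)
Lemma marc_of_arcs S1 S2 th T (plus : bool) :
  (forall w : C, S1 w -> (if plus then arc_plus th w else arc_minus th w) `<=` S2) ->
  (S1 0 -> S2 0) -> mcov S1 th T -> marc S2 th T.
Proof.
move=> arcs S120 H x x0; exists plus => a b ab h.
have [y0|y0] := eqVneq (T *m x) 0.
  by rewrite y0 polar_nil; apply/S120/(@cov_zero _ _ _ th x); rewrite -y0; apply: H.
have [A [EA _ A1]] := cosine_exists th x0 y0.
have AB : A ^+ 2 + Num.sqrt (1 - A ^+ 2) ^+ 2 = 1 by rewrite sqr_sqrtr ?subr_ge0// addrC subrK.
have xy0 : 0 < enorm x * enorm (T *m x) by rewrite mulr_gt0// enorm_gt0.
move: h; rewrite -EA !(ler_pM2r xy0) => /(polar_arc th x (T *m x) AB ab) arc.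
by have /arcs := H x x0 _ _ AB EA; case: plus arc {arcs} => arc; apply.
Qed.

Lemma SRGset_marc th (MM : set 'M[C]_m) M : MM M -> arc_property th MM ->
  marc (SRGset th MM) th M.
Proof.
move=> MMM arcs; have H := @SRGset_mcov th _ _ MMM; case: arcs => arcs.
  exact: (@marc_of_arcs _ _ _ _ true arcs id H).
exact: (@marc_of_arcs _ _ _ _ false arcs id H).
Qed.

Lemma polar_at_0 th : polar_at th (0 : C) 0.
Proof. by split; [rewrite lexx pi_ge0 | left; rewrite Normc.normc0 mul0r]. Qed.

Lemma arc_hull_marc S th T : mcov S th T -> marc (arc_hull th S) th T.
Proof.
move=> H; apply: (@marc_of_arcs S _ _ _ true _ _ H) => [z Sz w wz|S0]; first by exists z.
exists 0 => //; exists 0, 0; split; first exact: polar_at_0.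
  by rewrite normr0.
by rewrite Normc.normc0 mul0r.
Qed.

(* With [e^(-j th) T x = a x + b] and [b] orthogonal to [x], the points below are
   those of the chord between [e^(j th) (a +- j |b|/|x|)]; in this form the
   condition is additive in [T] by the triangle inequality for the [b]'s. *)
Definition mccov S th T : Prop := forall x, x != 0 -> forall a t,
  a * rin x x = rin x (cis (- th) *: (T *m x)) ->
  `|t| * enorm x <= enorm (cis (- th) *: (T *m x) - a%:C *: x) ->
  S (cis th * (a +i* t)).

Lemma enorm_orth_sqr x y a : a * rin x x = rin x y ->
  enorm (y - a%:C *: x) ^+ 2 = enorm y ^+ 2 - a ^+ 2 * enorm x ^+ 2.
Proof.
move=> E; rewrite !enorm_sqr !(rinDl, rinDr, rinNl, rinNr, rinZl, rinZr) (rinC y x) -E.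
by ring.
Qed.

(** A polar point is an end of its chord: there the bound on [t] is an equality, by Pythagoras. *)
Lemma mccov_mcov S th T : mccov S th T -> mcov S th T.
Proof.
move=> H x x0 a b ab E; have xn : 0 < enorm x by rewrite enorm_gt0.
set rho := enorm (T *m x) / enorm x.
have -> : polar th x (T *m x) a b = cis th * ((rho * a) +i* (rho * b)).
  by rewrite /polar -/rho [_%:C * cis th]mulrC -mulrA; congr (_ * _); simpc.
have E1 : (rho * a) * rin x x = rin x (cis (- th) *: (T *m x)).
  rewrite -E -enorm_sqr /rho.
  transitivity (enorm (T *m x) / enorm x * enorm x * (a * enorm x)); first by ring.
  by rewrite divfK ?gt_eqF//; ring.
apply: (H _ x0 _ _ E1); rewrite -(@ler_pXn2r _ 2)// ?nnegrE ?mulr_ge0 ?enorm_ge0//.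
rewrite (enorm_orth_sqr E1) enorm_cis exprMn real_normK ?num_real//.
have -> : enorm (T *m x) = rho * enorm x by rewrite divfK ?gt_eqF.
clearbody rho; rewrite !exprMn.
have -> : b ^+ 2 = 1 - a ^+ 2 by rewrite -ab; ring.
by rewrite le_eqVlt; apply/orP; left; apply/eqP; ring.
Qed.

Lemma norm_split (t f g : R) : 0 <= f -> 0 <= g -> `|t| <= f + g ->
  exists t1 t2, [/\ t = t1 + t2, `|t1| <= f & `|t2| <= g].
Proof.
move=> f0 g0; rewrite ler_norml => /andP[h1 h2].
have [tf|tf] := leP `|t| f; first by exists t, 0; rewrite addr0 normr0.
move: tf; have [t0|t0] := ger0P t => tf.
  by exists f, (t - f); split; rewrite ?ger0_norm; lra.
by exists (- f), (t + f); split; [lra|by rewrite normrN ger0_norm|rewrite ler0_norm; lra].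
Qed.

Lemma mccov_add S1 S2 th T1 T2 : mccov S1 th T1 -> mccov S2 th T2 ->
  mccov (set_add S1 S2) th (T1 + T2).
Proof.
move=> H1 H2 x x0 a t; rewrite mulmxDl scalerDr.
set Y1 := _ *: (T1 *m x); set Y2 := _ *: (T2 *m x) => E h.
have N0 : rin x x != 0 by rewrite rin_eq0.
pose a1 := rin x Y1 / rin x x; pose a2 := rin x Y2 / rin x x.
have E1 : a1 * rin x x = rin x Y1 by rewrite divfK.
have E2 : a2 * rin x x = rin x Y2 by rewrite divfK.
have aE : a = a1 + a2 by apply: (mulIf N0); rewrite E mulrDl E1 E2 rinDr.
have xn : 0 < enorm x by rewrite enorm_gt0.
have [|||t1 [t2 [tE h1 h2]]] := @norm_split t
  (enorm (Y1 - a1%:C *: x) / enorm x) (enorm (Y2 - a2%:C *: x) / enorm x).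
- by rewrite divr_ge0 ?enorm_ge0.
- by rewrite divr_ge0 ?enorm_ge0.
- rewrite -mulrDl ler_pdivlMr//; apply: le_trans h _.
  apply: le_trans (enorm_triangle _ _).
  by rewrite aE rmorphD /= scalerDl opprD addrACA.
exists (cis th * (a1 +i* t1)).
  rewrite ler_pdivlMr// in h1.
  pose proof (H1 x x0 a1 t1 E1 h1).
  assumption.
exists (cis th * (a2 +i* t2)).
  by rewrite ler_pdivlMr// in h2; apply: H2 h2.
by rewrite -mulrDr aE tE; simpc.
Qed.

Lemma segment_mem (w : C) (a d t : R) : `|t| <= `|d| ->
  segment (w * (a +i* d)) (w * (a -i* d)) (w * (a +i* t)).
Proof.
have [->|d0] := eqVneq d 0.
  rewrite normr0 normr_le0 => /eqP->; exists 0; split; first by rewrite lexx ler01.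
  by rewrite subr0 mul0r addr0 mul1r.
move=> h; have q : `|t / d| <= 1 by rewrite normf_div ler_pdivrMr ?normr_gt0// mul1r.
exists ((1 - t / d) / 2); split; first by move: q; rewrite ler_norml => /andP[]; lra.
rewrite [in RHS]mulrCA [X in _ + X]mulrCA -mulrDr; congr (_ * _).
by simpc; congr (_ +i* _); field.
Qed.

(** The vector [j x] is orthogonal to [x] for the real product, and e^(-j th) x = cos th x - j sin
    th x. Thus the identity needs the whole chord from 1 to e^(2 j th), which is why this segment,
    and not the number 1, is added to the petals at a hub. *)
Lemma segment_mccov th : mccov (segment 1 (cis (2 * th))) th (1%:M : 'M[C]_m).
Proof.
move=> x x0 a t; rewrite mul1mx rin_cisl cosN => E h.
have N0 : rin x x != 0 by rewrite rin_eq0.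
have {E}aE : a = cos th by apply: (mulIf N0); rewrite E.
have -> : 1 = cis th * (a +i* (- sin th)) :> C.
  by rewrite aE -(cisNK th) /cis cosN sinN.
have -> : cis (2 * th) = cis th * (a -i* (- sin th)) :> C.
  by rewrite opprK aE mulr_natl mulr2n cisD.
apply: segment_mem.
have xn : 0 < enorm x by rewrite enorm_gt0.
rewrite -(ler_pM2r xn); apply: (le_trans h); rewrite -scalerBl aE.
have -> : cis (- th) - (cos th)%:C = 0 +i* (- sin th) :> C.
  by rewrite /cis cosN sinN /=; apply/eqP; rewrite eq_complex /= subrr subr0 !eqxx.
rewrite -(@ler_pXn2r _ 2)// ?nnegrE ?mulr_ge0 ?enorm_ge0// exprMn real_normK ?num_real//.
rewrite !enorm_sqr !rinE mulr_sumr le_eqVlt; apply/orP; left; apply/eqP.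
by apply: eq_bigr => k _; rewrite !mxE; case: (x k ord0) => p q /=; ring.
Qed.

(** After division by e^(j th), the reflection in the definition of the chord is complex
    conjugation: the chord of a polar point has constant real part [a], and its imaginary part runs
    between the two signs of the sine term. *)
Lemma chord_hull_mccov S th T : mcov S th T -> mccov (chord_hull th S) th T.
Proof.
move=> H x x0 a t E h; have xn : 0 < enorm x by rewrite enorm_gt0.
set y := T *m x in E h *.
have [y0|y0] := eqVneq y 0.
  have N0 : rin x x != 0 by rewrite rin_eq0.
  have a0 : a = 0 by apply: (mulIf N0); rewrite E y0 scaler0 rin0r mul0r.
  have t0 : t = 0.
    move: h; rewrite y0 a0 scaler0 scale0r subrr enorm0 pmulr_lle0// normr_le0.
    by move/eqP.
  exists 0; first by apply: (@cov_zero _ _ _ th x); rewrite -y0; apply: H.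
  have := @segment_mem (cis th) 0 0 0 (lexx _).
  by rewrite a0 t0 /chord conjc0 mul0r oppr0 mulr0.
have [A [EA _ A1]] := cosine_exists th x0 y0.
set B := Num.sqrt (1 - A ^+ 2).
have AB : A ^+ 2 + B ^+ 2 = 1 by rewrite sqr_sqrtr ?subr_ge0// addrC subrK.
have rhoE : enorm y = (enorm y / enorm x) * enorm x by rewrite divfK ?gt_eqF.
set rho := enorm y / enorm x in rhoE.
have aE : a = rho * A.
  have n2 : enorm x ^+ 2 != 0 by rewrite expf_neq0 ?gt_eqF.
  apply: (mulIf n2).
  by rewrite {1}enorm_sqr E -EA rhoE; ring.
exists (polar th x y A B); first exact: H.
have zE : polar th x y A B = cis th * (a +i* (rho * B)).
  by rewrite /polar -/rho [_%:C * cis th]mulrC -mulrA aE; congr (_ * _); simpc.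
rewrite /chord.
have -> : conjc (polar th x y A B) * cis (2 * th) = cis th * (a -i* (rho * B)).
  rewrite zE.
  have -> : conjc (cis th * (a +i* (rho * B))) = cis (- th) * (a -i* (rho * B)) :> C.
    rewrite /cis cosN sinN /=; apply/eqP; rewrite eq_complex /=.
    by apply/andP; split; apply/eqP; ring.
  rewrite mulr_natl mulr2n cisD.
  transitivity ((cis th * cis (- th)) * (cis th * (a -i* (rho * B)))); first by ring.
  by rewrite cisNK mul1r.
rewrite zE; apply: segment_mem.
rewrite -(ler_pM2r xn); apply: (le_trans h).
rewrite -(@ler_pXn2r _ 2)// ?nnegrE ?mulr_ge0 ?enorm_ge0//.
rewrite (enorm_orth_sqr E) enorm_cis exprMn real_normK ?num_real// aE {1}rhoE.
have BE : B ^+ 2 = 1 - A ^+ 2 by rewrite -AB; ring.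
clearbody rho; rewrite !exprMn BE le_eqVlt; apply/orP; left; apply/eqP; ring.
Qed.

Definition set_inv S : set C := [set z | exists d, [/\ S d, d != 0 & z = d^-1]].

(** Inversion reverses the pair [y], [T y]: the gain is inverted, the cosine is unchanged and the
    reference angle changes sign. The sine [- b] makes the two points exact inverses. *)
Lemma mcov_inv S th T : T \in unitmx -> mcov S th T -> mcov (set_inv S) (- th) (invmx T).
Proof.
move=> uT H x x0 a b ab E.
set y := invmx T *m x in E *.
have xE : x = T *m y by rewrite /y mulmxA mulmxV// mul1mx.
have y0 : y != 0 by apply: contra_neq x0 => y0; rewrite xE y0 mulmx0.
exists (polar th y x a (- b)).
have P1 : polar th y x a (- b) * polar (- th) x y a b = 1.
  rewrite /polar.
  have c1 : (a -i* b) * (a +i* b) = 1 :> C.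
    by simpc; rewrite -!expr2 ab; congr (_ +i* _); ring.
  have c2 : (enorm x / enorm y)%:C * (enorm y / enorm x)%:C = 1 :> C.
    by rewrite -rmorphM /= mulrA divfK ?enorm_eq0// divff ?enorm_eq0.
  transitivity (((enorm x / enorm y)%:C * (enorm y / enorm x)%:C) *
    (cis th * cis (- th)) * ((a -i* b) * (a +i* b))); first by ring.
  by rewrite c1 c2 cisNK !mulr1.
have n0 : polar th y x a (- b) != 0.
  by apply: contra_eq_neq P1 => ->; rewrite mul0r eq_sym oner_neq0.
split=> //; last by apply: (mulfI n0); rewrite P1 divff.
have := H y y0 a (- b); rewrite -xE; apply; first by rewrite sqrrN.
by rewrite [enorm y * _]mulrC E opprK rinC -(rin_cis (- th)) scalerA mulrC cisNK scale1r.
Qed.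

Lemma mcov_div S D th1 th2 M T : T \in unitmx -> marc S th1 M -> mcov D th2 T ->
  mcov (set_div S D) (th1 - th2) (M *m invmx T).
Proof.
move=> uT HM /(mcov_inv uT) HT; rewrite addrC.
apply: mcov_sub (mcov_arc_r HT HM) => _ [_ [d [Dd d0 ->]]] [s Ss <-].
by exists s, d; rewrite mulrC.
Qed.

(** For a nonzero solution, T x = - x / sigma has gain 1 / sigma >= 1 and the direction opposite to
    [x], so [S] contains the point -1 / sigma of the half-line, whatever [th] is. *)
Lemma half_line_ker S th T (sigma : R) x : mcov S th T -> @half_line R `&` S = set0 ->
  0 <= sigma <= 1 -> x + sigma%:C *: (T *m x) = 0 -> x = 0.
Proof.
move=> H disj /andP[s0 s1] E; apply/eqP; apply/negPn/negP => x0.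
have sn : sigma != 0 by apply: contra_neq x0 => s_0; move: E; rewrite s_0 scale0r addr0.
have {}s0 : 0 < sigma by rewrite lt_def sn.
have yE : T *m x = (- sigma^-1)%:C *: x.
  have sT : sigma%:C *: (T *m x) = - x by apply: (addrI x); rewrite E subrr.
  have s1C : (sigma^-1)%:C * sigma%:C = 1 :> C by rewrite -rmorphM /= mulVf.
  by rewrite -[LHS]scale1r -s1C -scalerA sT scalerN -scaleNr -rmorphN.
have xn : 0 < enorm x by rewrite enorm_gt0.
have ny : enorm (T *m x) = sigma^-1 * enorm x.
  apply/eqP; rewrite -(@eqrXn2 _ 2)// ?mulr_ge0 ?enorm_ge0 ?invr_ge0// ?ltW//.
  by rewrite exprMn !enorm_sqr yE rinZl rinZr; apply/eqP; ring.
(* Relative to [th], the direction of [- x] has cosine [- cos th]; the sine [sin th] is the sign for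
   which the factor e^(j th) cancels. *)
have : S (polar th x (T *m x) (- cos th) (sin th)).
  apply: H => //; first by rewrite sqrrN cis_sqr.
  rewrite ny yE scalerA [cis _ * _]mulrC -scalerA rinZr rin_cisl cosN -enorm_sqr; ring.
have -> : polar th x (T *m x) (- cos th) (sin th) = (- sigma^-1)%:C.
  rewrite /polar ny mulfK ?gt_eqF//.
  have -> : (- cos th) +i* sin th = - cis (- th) :> C by rewrite /cis cosN sinN /=; simpc.
  by rewrite mulrN -mulrA cisNK mulr1 rmorphN.
move=> Sz; suff : (@half_line R `&` S) (- sigma^-1)%:C by rewrite disj.
split=> //; exists (- sigma^-1); split=> //.
by rewrite lerN2 invf_ge1.
Qed.

End Regions.

(** * Products along a loop and sums over petals *)

Section Chains.
Variables (R : realType) (m : nat) (I : finType).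
Local Notation C := R[i].
Implicit Types (s : seq I) (S : I -> set C) (th : I -> R) (T : I -> 'M[C]_m).

Definition seq_set (op : C -> C -> C) (idx : C) S s : set C :=
  foldr (fun k X => [set op a b | a in S k & b in X]) [set idx] s.

(** A repeated index would receive two independent elements, which one choice function cannot
    reproduce; hence [uniq s]. *)
Lemma seq_set_big (op : C -> C -> C) (idx : C) S s : uniq s ->
  seq_set op idx S s `<=` [set z | exists f : I -> C,
    (forall i, i \in s -> S i (f i)) /\ z = \big[op/idx]_(i <- s) f i].
Proof.
elim: s => [_ z ->|k s IH /= /andP[ks us] _ [a Sa [b /(IH us)[f [fS ->]] <-]]].
  by exists (fun=> 0); rewrite big_nil.
exists (fun i => if i == k then a else f i); split.
  by move=> i; rewrite inE; case: eqP => [-> _|_ /fS].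
rewrite big_cons eqxx; congr (op _ _); apply: eq_big_seq => i si.
by case: eqP si => // ->; rewrite (negPf ks).
Qed.

Lemma seq_set_sum S (J : {set I}) : seq_set +%R 0 S (enum J) `<=` set_sum J S.
Proof.
move=> z /seq_set_big[|f [fS ->]]; first exact: enum_uniq.
exists f; split=> [i iJ|]; first by apply: fS; rewrite mem_enum.
by rewrite big_enum.
Qed.

Lemma seq_set_prod S s : uniq s ->
  seq_set *%R 1 S s `<=` set_prod [set i in s] S.
Proof.
move=> us z /(seq_set_big us)[f [fS ->]]; exists f; split=> [i|].
  by rewrite inE => /fS.
by rewrite big_uniq//; apply: eq_bigl => i; rewrite inE.
Qed.

(** The head of the list acts first, so the list order is the order of traversal. *)
Fixpoint loopmx T s : 'M[C]_m :=
  if s is k :: s' then loopmx T s' *m T k else 1%:M.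

(** The part already composed needs no arcs, because every factor appended to it has them. *)
Lemma mcov_arcs S th T s (S0 : set C) (th0 : R) (T0 : 'M[C]_m) : mcov S0 th0 T0 ->
  (forall k, k \in s -> marc (S k) (th k) (T k)) ->
  mcov (set_mul S0 (seq_set *%R 1 S s)) (th0 + \sum_(k <- s) th k) (loopmx T s *m T0).
Proof.
elim: s S0 th0 T0 => [|k s IH] S0 th0 T0 H0 H.
  rewrite big_nil addr0 mul1mx; apply: mcov_sub H0 => z Sz.
  by exists z => //; exists 1; rewrite ?mulr1.
have Hk := mcov_arc_r H0 (H k (mem_head _ _)).
rewrite big_cons addrA /= -mulmxA; apply: mcov_sub (IH _ _ _ Hk _) => [|j js].
  move=> _ [_ [a Sa [b Sb <-]] [c Sc <-]]; exists a => //.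
  by exists (b * c); rewrite ?mulrA//; exists b => //; exists c.
by apply: H; rewrite inE js orbT.
Qed.

(* At most one factor has no arc property: starting from that factor, the chain
   is extended on both sides by factors that have it. *)
Lemma mcov_chain S th T s k0 : s != [::] -> uniq s ->
  (forall k, k \in s -> mcov (S k) (th k) (T k)) ->
  (forall k, k \in s -> k != k0 -> marc (S k) (th k) (T k)) ->
  mcov (seq_set *%R 1 S s) (\sum_(k <- s) th k) (loopmx T s).
Proof.
elim: s => // k s IH _ /= /andP[ks us] Hc Ha; rewrite big_cons.
have Hk : mcov (S k) (th k) (T k) by apply: Hc; rewrite mem_head.
have [E|kk0] := eqVneq k k0.
  apply: (mcov_arcs Hk) => j js; apply: Ha; first by rewrite inE js orbT.
  by rewrite -E; apply: contraNneq ks => <-.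
have Hk' : marc (S k) (th k) (T k) by apply: Ha; rewrite ?mem_head.
have [s0|s0] := eqVneq s [::].
  rewrite s0 big_nil addr0 mul1mx; apply: mcov_sub Hk => z Sz.
  by exists z => //; exists 1; rewrite ?mulr1.
have Hs : mcov (seq_set *%R 1 S s) (\sum_(j <- s) th j) (loopmx T s).
  apply: (IH s0 us) => j js; first by apply: Hc; rewrite inE js orbT.
  by apply: Ha; rewrite inE js orbT.
exact: mcov_arc_l Hk' Hs.
Qed.

Lemma mccov_seq_sum S (th0 : R) T s (S0 : set C) (T0 : 'M[C]_m) :
  mccov S0 th0 T0 -> (forall k, k \in s -> mccov (S k) th0 (T k)) ->
  mccov (set_add S0 (seq_set +%R 0 S s)) th0 (T0 + \sum_(k <- s) T k).
Proof.
elim: s S0 T0 => [|k s IH] S0 T0 H0 H.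
  rewrite big_nil addr0; have -> // : set_add S0 [set 0] = S0.
  apply/seteqP; split=> [_ [z Sz [_ -> <-]]|z Sz]; first by rewrite addr0.
  by exists z => //; exists 0; rewrite ?addr0.
rewrite big_cons addrA.
have -> : set_add S0 (seq_set +%R 0 S (k :: s)) =
          set_add (set_add S0 (S k)) (seq_set +%R 0 S s).
  apply/seteqP; split=> [_ [a Sa [_ [b Sb [c Sc <-]] <-]]|_ [_ [a Sa [b Sb <-]] [c Sc <-]]].
    by exists (a + b); [exists a => //; exists b | exists c; rewrite ?addrA].
  by exists a => //; exists (b + c); rewrite ?addrA//; exists b => //; exists c.
apply: IH; first by apply: mccov_add => //; apply: H; rewrite mem_head.
by move=> j js; apply: H; rewrite inE js orbT.
Qed.

Lemma mccov_sub (S1 S2 : set C) (t : R) (M : 'M[C]_m) : S1 `<=` S2 -> mccov S1 t M -> mccov S2 t M.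
Proof. by move=> S12 H x x0 a b E h; apply: S12; apply: (H x x0 a b E h). Qed.

Lemma mccov_zero (th0 : R) : mccov [set 0] th0 (0 : 'M[C]_m).
Proof.
move=> x x0 a t; rewrite mul0mx scaler0 rin0r => /eqP.
rewrite mulf_eq0 rin_eq0 (negPf x0) orbF => /eqP ->.
rewrite scale0r subrr enorm0 pmulr_lle0 ?enorm_gt0// normr_le0 => /eqP->.
exact: mulr0.
Qed.

Lemma mccov_sum S (th0 : R) T (J : {set I}) :
  (forall k, k \in J -> mccov (S k) th0 (T k)) ->
  mccov (set_sum J S) th0 (\sum_(k in J) T k).
Proof.
move=> H; have Hs k : k \in enum J -> mccov (S k) th0 (T k) by rewrite mem_enum; apply: H.
have := mccov_seq_sum (@mccov_zero th0) Hs; rewrite add0r big_enum /=.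
by apply: mccov_sub => _ [_ -> [z /seq_set_sum Sz <-]]; rewrite add0r.
Qed.

End Chains.

(** * Sunflower graphs *)

Section Loops.
Variables (T : finType) (e : rel T) (l : nat) (loop : 'I_l.+1 -> seq T).
Hypothesis sun : sunflower e loop.
Local Notation V := (loop_vertices loop).

Lemma loop_simple q : [/\ loop q != [::], cycle e (loop q) & uniq (loop q)].
Proof. by have [_ [H _ _] _ _] := sun; have /andP[? /andP[]] := H q. Qed.

Lemma loop_uniq q : uniq (loop q).
Proof. by have [] := loop_simple q. Qed.

Lemma mem_loop q k : (k \in V q) = (k \in loop q).
Proof. by rewrite inE. Qed.

(** Strong connectivity gives a duplicate-free path from [k] back to [j], which the edge closes to a
    simple loop. *)
Lemma in_edge_loop j k : e j k -> exists2 q, k \in loop q & prev (loop q) k = j.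
Proof.
have [[conn _] [_ _ enum] _ _] := sun => ejk.
have /connectP[p0 pp0 jE] := conn k j.
move: jE; case: (shortenP pp0) => p pp up _ jE.
have sl : simple_loop e (k :: p) by rewrite /simple_loop /ucycleb /= rcons_path pp -jE ejk.
have [q [n sE]] := enum _ sl; exists q; first by rewrite -(mem_rot n) -sE mem_head.
rewrite -(prev_rot n (loop_uniq q)) -sE jE.
have := cycle_next up; rewrite [cycle _ _]/= rcons_path => /andP[_ /eqP nE].
by rewrite -{2}nE prev_next.
Qed.

Lemma loop_in_edge q k : k \in loop q -> e (prev (loop q) k) k.
Proof. by have [_ c _] := loop_simple q => /(prev_cycle c). Qed.

Lemma prev_fixed (s : seq T) k : uniq s -> k \in s -> prev s k = k -> s = [:: k].
Proof.
move=> us ks pk; have [n s' sE] := rot_to ks.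
have us' : uniq (k :: s') by rewrite -sE rot_uniq.
have nk : next (k :: s') k = k by rewrite -sE next_rot// -{1}pk next_prev.
have s'0 : s' = [::].
  case: s' us' nk {sE} => //= y s'; rewrite eqxx => /andP[/negP ky _] yk.
  by case: ky; rewrite yk mem_head.
rewrite s'0 in sE; have : size s = 1%N by rewrite -(size_rot n) sE.
by case: s ks {us pk sE} => [|x []]//; rewrite inE => /eqP ->.
Qed.

Lemma loops_meet p q j k : p != q -> j \in loop p -> j \in loop q ->
  k \in loop p -> k \in loop q -> j = k.
Proof.
have [[_ meet] [_ inj _] _ _] := sun => pq jp jq kp kq.
have := meet (loop p) (loop q); case: sun => _ [sl _ _] _ _.
move=> /(_ (sl p) (sl q) (fun H => negP pq (introT eqP (inj _ _ H)))) /card_le1_eqP.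
by apply; rewrite !inE ?jp ?jq ?kp ?kq.
Qed.

(** Distinct loops sharing an edge share both of its ends; these coincide in a cactus, so both loops
    are the self-loop at [k]. *)
Lemma loop_prev_inj p q k : k \in loop p -> k \in loop q ->
  prev (loop p) k = prev (loop q) k -> p = q.
Proof.
move=> kp kq E; apply/eqP/negPn/negP => pq.
have pk : prev (loop p) k = k.
  by apply: (loops_meet pq) => //; [rewrite mem_prev | rewrite E mem_prev].
have pE := prev_fixed (loop_uniq p) kp pk.
have qE := prev_fixed (loop_uniq q) kq (etrans (esym E) pk).
case: sun => _ [_ inj _] _ _; case/eqP: pq; apply: inj; exists 0%N.
by rewrite rot0 pE qE.
Qed.

(** The edges into [k] correspond bijectively to the loops through [k]. *)
Lemma sum_in_edges (W : zmodType) k (F : T -> W) : (forall j, ~~ e j k -> F j = 0) ->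
  \sum_j F j = \sum_(q | k \in loop q) F (prev (loop q) k).
Proof.
move=> F0.
have inj : {in [pred q | k \in loop q] &, injective (fun q => prev (loop q) k)}.
  by move=> p q; rewrite !inE; apply: loop_prev_inj.
pose D : {set T} := [set prev (loop q) k | q in [pred q | k \in loop q]]%SET.
transitivity (\sum_(j in D) F j).
  rewrite [LHS](bigID (mem D)) /= [X in _ + X]big1 ?addr0// => j jN.
  apply: F0; apply: contra jN => /in_edge_loop[q kq <-].
  by apply/imsetP; exists q.
by rewrite big_imset.
Qed.

Lemma vertex_in_loop k : exists q, k \in loop q.
Proof.
have [[conn _] _ _ _] := sun.
have [s0 _ _] := loop_simple ord0; case sE : (loop ord0) s0 => [|c s] // _.
have /connectP[p] := conn c k; case/lastP: p => [|p x].
  by move=> _ /= ->; exists ord0; rewrite sE mem_head.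
rewrite rcons_path last_rcons => /andP[_ exk] ->.
by have [q ? _] := in_edge_loop exk; exists q.
Qed.

Lemma two_loops_central p q k : p != q -> k \in loop p -> k \in loop q -> k \in loop ord0.
Proof.
move=> pq kp kq; have [_ _ _ H] := sun; have /fintype.subsetP/(_ k) := H p q pq.
by rewrite !inE kp kq; apply.
Qed.

Lemma hubP k : reflect (k \in loop ord0 /\ exists2 q, q != ord0 & k \in loop q)
  (k \in hubs loop).
Proof.
rewrite !inE; apply: (iffP andP) => [[-> /existsP[q]]|[-> [q q0 kq]]].
  by rewrite mem_loop => /andP[q0 kq]; split=> //; exists q.
by split=> //; apply/existsP; exists q; rewrite mem_loop q0.
Qed.

Lemma petal_hub q : q != ord0 -> exists2 i, i \in loop ord0 & i \in loop q.
Proof.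
move=> q0; have [_ _ H _] := sun; have /finset.set0Pn[j] := H q q0.
by rewrite !inE => /andP[? ?]; exists j.
Qed.

Lemma unique_loop p k : k \notin hubs loop -> k \in loop p ->
  forall q, (k \in loop q) = (q == p).
Proof.
move=> kh kp q; apply/idP/eqP => [kq|->//]; apply/eqP/negPn/negP => qp.
have k0 := two_loops_central qp kq kp.
case/negP: kh; apply/hubP; split=> //.
have [E|] := eqVneq q ord0; last by exists q.
by exists p => //; rewrite -E eq_sym.
Qed.

End Loops.

(** * Propagation of a signal along a loop *)

Section Signals.
Variables (R : realType) (m : nat) (T : finType).
Local Notation C := R[i].
Implicit Types (s : seq T) (f : T -> 'cV[C]_m) (M : T -> 'M[C]_m) (G : T -> C).

Lemma loopmx_rcons M s k : loopmx M (rcons s k) = M k *m loopmx M s.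
Proof. by elim: s => [|j s IH] /=; rewrite ?mul1mx ?mulmx1// IH mulmxA. Qed.

Lemma path_signal M G f (nx : T -> T) x p : fpath nx x p ->
  (forall j, j \in belast x p -> f (nx j) = G j *: (M j *m f j)) ->
  f (last x p) = (\prod_(j <- belast x p) G j) *: (loopmx M (belast x p) *m f x).
Proof.
elim: p x => [x _ _|y p IH x /= /andP[/eqP <- pp] H]; first by rewrite big_nil scale1r mul1mx.
rewrite (IH _ pp) => [|j jp]; last by apply: H; rewrite inE jp orbT.
by rewrite big_cons (H x) ?mem_head// -scalemxAr scalerA mulmxA [_ * G x]mulrC.
Qed.

Lemma path_zero M G f (nx : T -> T) x p : fpath nx x p ->
  (forall j, j \in belast x p -> f (nx j) = G j *: (M j *m f j)) ->
  f x = 0 -> forall k, k \in x :: p -> f k = 0.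
Proof.
elim: p x => [x _ _ fx k|y p IH x /= /andP[/eqP nE pp] H fx k]; first by rewrite inE => /eqP->.
rewrite inE => /orP[/eqP->//|]; apply: IH => //.
  by move=> j jp; apply: H; rewrite inE jp orbT.
by rewrite -nE (H x) ?mem_head// fx mulmx0 scaler0.
Qed.

Lemma cycle_path s i : uniq s -> i \in s -> exists p,
  [/\ rot (index i s) s = i :: p, fpath (next s) i p, next s (last i p) = i
    & forall j, j \in belast i p -> j \in s /\ next s j != i].
Proof.
move=> us is_; have := rot_index is_; set p := _ ++ _ => E; exists p.
have up : uniq (i :: p) by rewrite -E rot_uniq.
have nE : next (i :: p) =1 next s by move=> k; rewrite -E next_rot.
have := cycle_next up; rewrite [cycle _ _]/= rcons_path => /andP[pp /eqP].
rewrite nE => lE; split=> //.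
  have /eq_path <- // : frel (next (i :: p)) =2 frel (next s).
  by move=> x y; rewrite /frel -[LHS]/(next (i :: p) x == y) nE.
move=> j jp; have js : j \in s.
  rewrite -(mem_rot (index i s)) E. exact: mem_belast jp.
split=> //; apply/eqP => nj; have jl : j = last i p.
  by rewrite -(prev_next us j) nj -{1}lE prev_next.
by move: up; rewrite lastI rcons_uniq -jl jp.
Qed.

(** No equation is assumed at [i], where the signals of several loops may add up; the left-hand side
    is what the loop [s] brings back to [i]. *)
Lemma loop_signal M G f s i : uniq s -> i \in s ->
  (forall k, k \in s -> k != i ->
     f k = G (prev s k) *: (M (prev s k) *m f (prev s k))) ->
  G (prev s i) *: (M (prev s i) *m f (prev s i)) =
  (\prod_(k in [set k in s]) G k) *: (loopmx M (rot (index i s) s) *m f i).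
Proof.
move=> us is_ H; have [p [E pp lE bp]] := cycle_path us is_.
have -> : prev s i = last i p by rewrite -{1}lE prev_next.
rewrite (path_signal (M := M) (G := G) (f := f) pp) => [|j /bp[js jn]].
  have -> : \prod_(k in [set k in s]) G k = G (last i p) * \prod_(j <- belast i p) G j.
    transitivity (\prod_(k <- s) G k).
      by rewrite big_uniq//; apply: eq_bigl => k; rewrite inE.
    rewrite (perm_big (rot (index i s) s)); last by rewrite perm_sym perm_rot.
    by rewrite E lastI big_rcons /= mulrC.
  by rewrite E lastI loopmx_rcons -scalemxAr scalerA mulmxA.
by rewrite (H (next s j)) ?mem_next// prev_next.
Qed.

Lemma loop_zero M G f s i : uniq s -> i \in s ->
  (forall k, k \in s -> k != i ->
     f k = G (prev s k) *: (M (prev s k) *m f (prev s k))) ->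
  f i = 0 -> forall k, k \in s -> f k = 0.
Proof.
move=> us is_ H fi k; have [p [E pp lE bp]] := cycle_path us is_.
rewrite -(mem_rot (index i s)) E.
have step j : j \in belast i p -> f (next s j) = G j *: (M j *m f j).
  by move=> /bp[js jn]; rewrite (H (next s j)) ?mem_next// prev_next.
exact: (path_zero pp step fi).
Qed.

End Signals.

(** * The network at a fixed frequency *)

Lemma unitmx_kernel (F : fieldType) n (X : 'M[F]_n) :
  (forall u : 'cV[F]_n, X *m u = 0 -> u = 0) -> X \in unitmx.
Proof.
move=> H; rewrite -unitmx_tr unitmxE unitfE; apply/det0P => -[v v0 vX].
case/eqP: v0; apply: trmx_inj; rewrite trmx0; apply: H.
by rewrite -[X]trmxK -trmx_mul vX trmx0.
Qed.

Section Kernel.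
Variables (R : realType) (N l : nat) (e : rel 'I_N) (loop : 'I_l.+1 -> seq 'I_N).
Variable A : 'M[R]_N.
Hypotheses (sun : sunflower e loop) (adj : signed_adjacency e A).
Local Notation C := R[i].

(* The negative edge of the central loop is scaled by [tau], those of the petals
   by [sigma]: all loop products of a given kind are scaled together. *)
Definition scaled_adjacency (sigma tau : R) : 'M[R]_N :=
  \matrix_(k, j) if A k j == -1 then
      if (k \in loop ord0) && (j == prev (loop ord0) k) then - tau else - sigma
    else A k j.

Lemma scaled_adjacency1 : scaled_adjacency 1 1 = A.
Proof. by apply/matrixP => k j; rewrite mxE; case: eqP => [->|//]; rewrite if_same. Qed.

Lemma scaled_adjacency_loop sigma tau q :
  \prod_(k in [set k in loop q])
    (scaled_adjacency sigma tau (next (loop q) k) k)%:C =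
  (if q == ord0 then - tau else - sigma)%:C :> C.
Proof.
have [_ [sl _ _] _ _] := sun; have [A1 _ Aneg] := adj.
have uq := loop_uniq sun q.
have := Aneg _ (sl q) => /eqP/cards1P[x xE].
have xP k : k \in loop q -> (A (next (loop q) k) k == -1) = (k == x).
  move=> kq; have : (k \in [set x0 in loop q | A (next (loop q) x0) x0 == -1]) = (k == x).
    by rewrite xE inE.
  by rewrite !inE kq.
have xq : x \in loop q.
  have : x \in [set x0 in loop q | A (next (loop q) x0) x0 == -1] by rewrite xE inE.
  by rewrite !inE => /andP[].
rewrite (bigD1 x) /=; last by rewrite inE.
rewrite [X in _ * X]big1 => [|k /andP[]]; last first.
  rewrite inE => kq kx; have eq_ : e k (next (loop q) k).
    have := loop_in_edge sun (q := q); move=> /(_ (next (loop q) k)).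
    by rewrite mem_next prev_next//; apply.
  by rewrite mxE xP// (negPf kx); have [->//|] := A1 _ _ eq_; move/eqP; rewrite xP// (negPf kx).
rewrite mulr1 mxE xP// eqxx; congr (real_complex _ _).
have [E|q0] := eqVneq q ord0; first by rewrite -E mem_next xq prev_next ?eqxx.
(* A negative petal edge lying also on the central loop would make the two loops equal, so it
   carries [sigma]. *)
case: ifP => // /andP[n0 /eqP xp]; case/eqP: q0.
have nq : next (loop q) x \in loop q by rewrite mem_next.
by apply: (loop_prev_inj sun nq n0); rewrite -xp prev_next.
Qed.

Variables (m : nat) (M : 'I_N -> 'M[C]_m).

Definition petal_return (i : 'I_N) : 'M[C]_m :=
  \sum_(q in petals_at loop i) loopmx M (rot (index i (loop q)) (loop q)).

(** At a hub, f_i = c - sigma W f_i with [c] the signal arriving along the central loop and [W] the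
    petal return; this matrix sends [c] to M_i f_i. *)
Definition hub_transfer (sigma : R) (i : 'I_N) : 'M[C]_m :=
  if i \in hubs loop then M i *m invmx (1%:M + sigma%:C *: petal_return i) else M i.

(** At a hub [f] also collects the petals, so the unknown followed around the central loop is the
    signal [inc ord0] arriving along that loop. Once it vanishes, [f] vanishes on the central loop,
    and then along each petal starting from its hub. *)
Lemma scaled_kernel (sigma tau : R) (f : 'I_N -> 'cV[C]_m) :
  (forall i, i \in hubs loop -> forall u : 'cV[C]_m,
     u + sigma%:C *: (petal_return i *m u) = 0 -> u = 0) ->
  (forall c : 'cV[C]_m,
     c + tau%:C *: (loopmx (hub_transfer sigma) (loop ord0) *m c) = 0 -> c = 0) ->
  (forall k, f k = \sum_j (scaled_adjacency sigma tau k j)%:C *: (M j *m f j)) ->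
  forall k, f k = 0.
Proof.
move=> hub_ker central_ker fE.
set B := scaled_adjacency sigma tau in fE *.
pose inc q k : 'cV[C]_m :=
  (B k (prev (loop q) k))%:C *: (M (prev (loop q) k) *m f (prev (loop q) k)).
have f_inc k : f k = \sum_(q | k \in loop q) inc q k.
  rewrite fE (sum_in_edges (k := k) sun) // => j ejk; have [_ A0 _] := adj.
  rewrite mxE A0//; case: eqP => [/esym/eqP|_]; first by rewrite oppr_eq0 oner_eq0.
  by rewrite scale0r.
have f1 q k : k \notin hubs loop -> k \in loop q -> f k = inc q k.
  move=> kh kq; rewrite f_inc (big_pred1 q)// => p.
  by rewrite (unique_loop sun kh kq).
have prevB q k : k \in loop q -> inc q k =
    (B (next (loop q) (prev (loop q) k)) (prev (loop q) k))%:C *: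
    (M (prev (loop q) k) *m f (prev (loop q) k)).
  by move=> kq; rewrite /inc next_prev ?(loop_uniq sun).
(* By the cactus property a petal has no second vertex on the central loop, so its other vertices
   have a single incoming signal. *)
have petal_only q i k : q != ord0 -> i \in loop ord0 -> i \in loop q ->
    k \in loop q -> k != i -> k \notin hubs loop.
  move=> q0 i0 iq kq ki; apply/negP => /hubP[k0 _].
  by case/eqP: ki; apply: (loops_meet sun q0).
have petal_signal q i : q != ord0 -> i \in loop ord0 -> i \in loop q ->
    inc q i = - sigma%:C *: (loopmx M (rot (index i (loop q)) (loop q)) *m f i).
  move=> q0 i0 iq; rewrite prevB//.
  rewrite (loop_signal (M := M) (G := fun j => (B (next (loop q) j) j)%:C) (f := f))
    ?(loop_uniq sun)//.
    by rewrite scaled_adjacency_loop (negPf q0) rmorphN.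
  by move=> k kq ki; rewrite -prevB//; exact: f1 (petal_only q i k q0 i0 iq kq ki) kq.
have central_step k : k \in loop ord0 ->
    M k *m f k = hub_transfer sigma k *m inc ord0 k.
  move=> k0; rewrite /hub_transfer; case: ifPn => kh; last by rewrite (f1 _ _ kh k0).
  have uX : (1%:M + sigma%:C *: petal_return k) \in unitmx.
    apply: unitmx_kernel => u; rewrite mulmxDl mul1mx -scalemxAl; exact: hub_ker kh u.
  have -> : inc ord0 k = (1%:M + sigma%:C *: petal_return k) *m f k.
    rewrite mulmxDl mul1mx -scalemxAl mulmx_suml scaler_sumr.
    rewrite {1}[f k]f_inc (bigD1 ord0)//= -addrA -[LHS]addr0; congr (_ + _).
    apply/esym/eqP; rewrite addr_eq0; apply/eqP.
    rewrite -sumrN; apply: eq_big => [q|q /andP[kq q0]]; last first.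
      by rewrite petal_signal// scaleNr.
    by rewrite !inE andbC.
  by rewrite mulmxA mulmxKV.
have [c0 c0l] : exists c0, loop ord0 = c0 :: behead (loop ord0).
  by have [] := loop_simple sun ord0; case: (loop ord0) => // c s _ _ _; exists c.
have c0in : c0 \in loop ord0 by rewrite c0l mem_head.
have inc_step k : k \in loop ord0 -> inc ord0 k =
    (B (next (loop ord0) (prev (loop ord0) k)) (prev (loop ord0) k))%:C *:
    (hub_transfer sigma (prev (loop ord0) k) *m inc ord0 (prev (loop ord0) k)).
  by move=> k0; rewrite prevB// central_step ?mem_prev.
have inc_c0 : inc ord0 c0 = 0.
  apply: central_ker; apply/eqP; rewrite addr_eq0 {1}inc_step//; apply/eqP.
  rewrite (loop_signal (M := hub_transfer sigma)
     (G := fun j => (B (next (loop ord0) j) j)%:C) (f := inc ord0)) ?(loop_uniq sun)//.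
    have -> : index c0 (loop ord0) = 0%N by rewrite c0l /= eqxx.
    by rewrite rot0 scaled_adjacency_loop eqxx rmorphN scaleNr.
  by move=> k k0 _; apply: inc_step.
have inc0 k : k \in loop ord0 -> inc ord0 k = 0.
  apply: (loop_zero (M := hub_transfer sigma)
     (G := fun j => (B (next (loop ord0) j) j)%:C) (f := inc ord0)) inc_c0 _ => //.
    exact: (loop_uniq sun).
  by move=> j j0 _; apply: inc_step.
have f0 k : k \in loop ord0 -> f k = 0.
  move=> k0; case kh: (k \in hubs loop); last by rewrite (f1 ord0)// ?kh// inc0.
  apply: (hub_ker k kh); rewrite mulmx_suml scaler_sumr.
  rewrite {1}[f k]f_inc (bigD1 ord0)//= inc0// add0r.
  apply/eqP; rewrite addr_eq0; apply/eqP.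
  rewrite -sumrN; apply: eq_big => [q|q /andP[kq q0]]; last first.
    by rewrite petal_signal// scaleNr.
  by rewrite !inE andbC.
move=> k; have [q kq] := vertex_in_loop sun k.
have [q0|q0] := eqVneq q ord0; first by apply: f0; rewrite -q0.
have [i i0 iq] := petal_hub sun q0.
have step j : j \in loop q -> j != i -> f j =
    (B (next (loop q) (prev (loop q) j)) (prev (loop q) j))%:C *:
    (M (prev (loop q) j) *m f (prev (loop q) j)).
  by move=> jq ji; rewrite -prevB//; exact: f1 (petal_only q i j q0 i0 iq jq ji) jq.
exact: (loop_zero (M := M) (G := fun j => (B (next (loop q) j) j)%:C)
  (loop_uniq sun q) iq step (f0 i i0)).
Qed.

End Kernel.

(** * Separation from the half-line excludes nonzero signals *)

Section Separation.
Variables (R : realType) (N l m : nat) (e : rel 'I_N) (loop : 'I_l.+1 -> seq 'I_N).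
Hypothesis sun : sunflower e loop.
Local Notation C := R[i].
Variables (M : 'I_N -> 'M[C]_m) (MM : 'I_N -> set 'M[C]_m).
Variables (xi eta theta : 'I_N -> R).
Hypothesis adm : admissible loop xi eta M MM.
Hypothesis thetaE : forall i, i \in hubs loop -> forall q, q \in petals_at loop i ->
  theta i = \sum_(k in loop_vertices loop q) xi k.

Lemma all_but_one (T : finType) (V K : {set T}) : K \subset V -> (#|V| - 1 <= #|K|)%N ->
  V != finset.set0 -> exists k0, forall k, k \in V -> k != k0 -> k \in K.
Proof.
move=> KV cK /finset.set0Pn[v vV].
have : (#|V :\: K| <= 1)%N.
  have := cardsID K V; rewrite (finset.setIidPr KV) => cE; move: cK; rewrite -cE; lia.
rewrite leq_eqVlt ltnS leqn0 => /orP[/cards1P[k0 E]|]; last first.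
  rewrite cards_eq0 => /eqP E; exists v => k kV _; apply/negPn/negP => kK.
  by have : k \in V :\: K; [rewrite inE kK kV | rewrite E inE].
exists k0 => k kV kk0; apply/negPn/negP => kK.
by have : k \in V :\: K; [rewrite inE kK kV | rewrite E inE (negPf kk0)].
Qed.

Lemma petal_mcov i q : i \in hubs loop -> q \in petals_at loop i ->
  mcov (set_prod (loop_vertices loop q) (fun k => SRGset (xi k) (MM k)))
    (theta i) (loopmx M (rot (index i (loop q)) (loop q))).
Proof.
move=> ih qi; have [MMM arcs _ _] := adm; rewrite (thetaE ih qi).
have [K [KV cK Karc]] := arcs i ih q qi.
have [q0 cq uq] := loop_simple sun q.
have cV : #|loop_vertices loop q| = size (loop q).
  by rewrite /loop_vertices cardsE; apply/card_uniqP.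
have iV : i \in loop_vertices loop q by move: qi; rewrite inE => /andP[].
have [||k0 hk0] := all_but_one KV; first by rewrite cV.
  by apply/finset.set0Pn; exists i.
(* The traversal starts at the hub; the product of regions and the sum of angles do not see the
   rotation. *)
set s := rot _ _.
have sV : [set k in s] = loop_vertices loop q by apply/setP => k; rewrite !inE mem_rot.
have us : uniq s by rewrite rot_uniq.
have -> : \sum_(k in loop_vertices loop q) xi k = \sum_(k <- s) xi k.
  by rewrite big_uniq//; apply: eq_bigl => k; rewrite -sV inE.
rewrite -sV; apply: mcov_sub (seq_set_prod us) _.
apply: (mcov_chain (k0 := k0)) => //.
- by rewrite -size_eq0 size_rot size_eq0.
- by move=> k ks; apply: SRGset_mcov.
- move=> k ks kk0; apply: SRGset_marc => //; apply: Karc; apply: hk0 => //.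
  by rewrite -sV inE.
Qed.

Lemma petal_region_mccov i : i \in hubs loop ->
  mccov (petal_region loop xi theta MM i) (theta i) (petal_return loop M i).
Proof.
by move=> ih; apply: mccov_sum => q qi; apply: chord_hull_mccov; apply: petal_mcov.
Qed.

Hypothesis hub_sep : forall i, i \in hubs loop ->
  @half_line R `&` petal_region loop xi theta MM i = set0.

Lemma hub_kernel sigma i (u : 'cV[C]_m) : 0 <= sigma <= 1 -> i \in hubs loop ->
  u + sigma%:C *: (petal_return loop M i *m u) = 0 -> u = 0.
Proof.
move=> s01 ih; apply: half_line_ker (hub_sep ih) s01.
exact: mccov_mcov (petal_region_mccov ih).
Qed.

(** The quotient is covered thanks to the arcs of the hub's own matrix set; the hull then provides
    the arcs of the quotient. *)
Lemma hub_region_marc i : i \in hubs loop ->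
  marc (hub_region loop xi eta theta MM i) (eta i - theta i) (hub_transfer loop M 1 i).
Proof.
move=> ih; rewrite /hub_transfer ih scale1r; apply: arc_hull_marc.
have [MMM _ harc _] := adm; apply: mcov_div.
- apply: unitmx_kernel => u; rewrite mulmxDl mul1mx -[petal_return _ _ _]scale1r -scalemxAl.
  by apply: hub_kernel => //; rewrite ler01 lexx.
- by apply: SRGset_marc => //; apply: harc.
- apply: mccov_mcov; apply: mccov_add (petal_region_mccov ih).
  exact: segment_mccov.
Qed.

Hypothesis central_sep :
  @half_line R `&` central_region loop xi eta theta MM = set0.

(** Hub factors all have arcs, so the only factor that may lack them is the exceptional non-hub
    vertex. *)
Lemma central_kernel tau (c : 'cV[C]_m) : 0 <= tau <= 1 ->
  c + tau%:C *: (loopmx (hub_transfer loop M 1) (loop ord0) *m c) = 0 -> c = 0.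
Proof.
move=> t01; have [MMM _ _ [E [E1 Earc]]] := adm.
pose S k := if k \in hubs loop then hub_region loop xi eta theta MM k
            else SRGset (eta k) (MM k).
pose th k := if k \in hubs loop then eta k - theta k else eta k.
have [s0 _ us] := loop_simple sun ord0.
(* Without an exceptional vertex, any vertex of the loop can serve as [k0]. *)
have [k0 hk0] : exists k0, forall k, k \in E -> k = k0.
  have [c0 _] : exists c0, c0 \in loop ord0.
    by case: (loop ord0) s0 => // x s; exists x; rewrite mem_head.
  case: (set_0Vmem E) => [->|[k0 k0E]]; first by exists c0 => k; rewrite inE.
  by exists k0 => k kE; apply: (card_le1_eqP E1).
have sub : seq_set *%R 1 S (loop ord0) `<=` central_region loop xi eta theta MM.
  move=> z /(seq_set_prod us)[f [fS ->]].
  have fV k : k \in loop_vertices loop ord0 -> S k (f k) by move=> kV; apply: fS.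
  exists (\prod_(k in loop_vertices loop ord0 :\: hubs loop) f k).
    exists f; split=> // k; rewrite inE => /andP[kh kV].
    by have := fV k kV; rewrite /S (negPf kh).
  exists (\prod_(k in hubs loop) f k).
    exists f; split=> // k kh; have := fV k; rewrite /S kh; apply.
    by move: kh; rewrite inE => /andP[].
  rewrite mulrC [RHS](big_setID (hubs loop)) /=; congr (_ * _).
  apply: eq_bigl => k; rewrite [RHS]inE andb_idl// => /hubP[k0l _].
  by rewrite inE.
apply: (half_line_ker _ central_sep t01).
  apply: mcov_sub sub _; apply: (mcov_chain (th := th) (k0 := k0)) => //.
    move=> k ks; rewrite /S /th; case: ifPn => kh; first exact: marc_mcov (hub_region_marc kh).
    by rewrite /hub_transfer (negPf kh); apply: SRGset_mcov.
move=> k ks kk0; rewrite /S /th; case: ifPn => kh; first exact: hub_region_marc.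
rewrite /hub_transfer (negPf kh); apply: SRGset_marc => //; apply: Earc.
  by rewrite finset.in_setD kh inE.
by apply: contra kk0 => /hk0 ->.
Qed.

End Separation.

(** * Homotopies of Hurwitz polynomials *)

Section Hurwitz.
Variable R : realType.
Local Notation C := R[i].
Local Notation nrm := (@Normc.normc R).
Implicit Types (p q : {poly R}) (s : C).

Definition hurwitz p : Prop := forall s, polyval p s = 0 -> complex.Re s < 0.

Lemma nrm_ge0 s : 0 <= nrm s.
Proof. by case: s => a b /=; apply: sqrtr_ge0. Qed.

Lemma nrm_ge_Re s : `|complex.Re s| <= nrm s.
Proof.
case: s => a b /=; rewrite -(@ler_pXn2r _ 2)// ?nnegrE ?sqrtr_ge0//.
rewrite sqr_sqrtr ?addr_ge0 ?sqr_ge0// real_normK ?num_real//.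
by rewrite lerDl sqr_ge0.
Qed.

Lemma nrm_sum (I : Type) (r : seq I) (F : I -> C) :
  nrm (\sum_(k <- r) F k) <= \sum_(k <- r) nrm (F k).
Proof.
elim: r => [|k r IH]; first by rewrite !big_nil Normc.normc0.
rewrite !big_cons; apply: le_trans (le_normcD _ _) _.
by rewrite lerD2l.
Qed.

Lemma nrmX s n : nrm (s ^+ n) = nrm s ^+ n.
Proof. by elim: n => [|n IH]; rewrite ?expr0 ?Normc.normc1// !exprS Normc.normcM IH. Qed.

Lemma nrm_real (a : R) : nrm a%:C = `|a|.
Proof. by rewrite /= expr0n addr0 sqrtr_sqr. Qed.

Lemma polyvalE p s n : (size p <= n)%N -> polyval p s = \sum_(k < n) (p`_k)%:C * s ^+ k.
Proof.
move=> sp; rewrite /polyval (@horner_coef_wide _ n) ?size_map_poly//.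
by apply: eq_bigr => k _; rewrite coef_map.
Qed.

Lemma polyval_dist p q s n (eps : R) : (size p <= n.+1)%N -> (size q <= n.+1)%N ->
  (forall k : 'I_n.+1, `|p`_k - q`_k| <= eps) ->
  nrm (polyval p s - polyval q s) <= n.+1%:R * eps * (1 + nrm s) ^+ n.
Proof.
move=> sp sq H; rewrite (polyvalE _ sp) (polyvalE _ sq) -sumrB.
apply: le_trans (nrm_sum _ _) _.
have -> : n.+1%:R * eps * (1 + nrm s) ^+ n = \sum_(k < n.+1) eps * (1 + nrm s) ^+ n.
  by rewrite sumr_const card_ord mulr_natl -mulrnAl.
apply: ler_sum => k _; rewrite -mulrBl -rmorphB Normc.normcM nrmX nrm_real.
have h1 : 1 <= 1 + nrm s by rewrite lerDl nrm_ge0.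
apply: ler_pM; rewrite ?normr_ge0 ?exprn_ge0 ?nrm_ge0//.
apply: (@le_trans _ _ ((1 + nrm s) ^+ k)).
  by rewrite lerXn2r ?nnegrE ?nrm_ge0// ?lerDr// (le_trans _ h1).
by rewrite ler_weXn2l// -ltnS.
Qed.

Lemma polyval_roots p n : size p = n.+1 -> exists r : seq C, size r = n /\
  forall s, polyval p s = (p`_n)%:C * \prod_(z <- r) (s - z).
Proof.
move=> sp; have [r rE] := closed_field_poly_normal (map_poly (real_complex R) p).
have lc : lead_coef (map_poly (real_complex R) p) = (p`_n)%:C.
  by rewrite lead_coefE size_map_poly sp coef_map.
have pn0 : (p`_n)%:C != 0 :> C.
  rewrite -lc lead_coef_eq0 map_poly_eq0 -size_poly_eq0 sp; by [].
exists r; split.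
  have : size (map_poly (real_complex R) p) = n.+1 by rewrite size_map_poly.
  by rewrite rE lc size_scale// size_prod_XsubC => -[].
move=> s; rewrite /polyval rE lc hornerZ horner_prod; congr (_ * _).
by apply: eq_bigr => z _; rewrite hornerXsubC.
Qed.

Lemma hurwitz_lower p n : size p = n.+1 -> hurwitz p -> exists c : R, 0 < c /\
  forall s, 0 <= complex.Re s -> c * (1 + nrm s) ^+ n <= nrm (polyval p s).
Proof.
move=> sp hp; have [r [rn pE]] := polyval_roots sp.
have pn0 : 0 < `|p`_n|.
  rewrite normr_gt0; have : lead_coef p != 0 by rewrite lead_coef_eq0 -size_poly_eq0 sp.
  by rewrite lead_coefE sp.
have r0 z : z \in r -> complex.Re z < 0.
  by move=> zr; apply: hp; rewrite pE (big_rem z)//= subrr mul0r mulr0.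
suff [c [c0 cP]] : exists c : R, 0 < c /\ forall s, 0 <= complex.Re s ->
    c * (1 + nrm s) ^+ n <= \prod_(z <- r) nrm (s - z).
  exists (`|p`_n| * c); split=> [|s s0]; first by rewrite mulr_gt0.
  rewrite pE Normc.normcM nrm_real -mulrA ler_wpM2l// (le_trans (cP s s0))//.
  by rewrite (big_morph nrm (@Normc.normcM R) (@Normc.normc1 R)).
rewrite -rn; elim: r r0 {rn pE} => [_|z r IH r0].
  by exists 1; split=> // s _; rewrite big_nil expr0 mulr1.
have [|c [c0 cP]] := IH; first by move=> y yr; apply: r0; rewrite inE yr orbT.
have z0 : complex.Re z < 0 by apply: r0; rewrite mem_head.
pose d := - complex.Re z; have d0 : 0 < d by rewrite oppr_gt0.
have D0 : 0 < 1 + d + nrm z by have := nrm_ge0 z; lra.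
(* From [d <= |s - z|] and [|s| <= |s - z| + |z|] follows [d (1 + |s|) <= (1 + d + |z|) |s - z|]. *)
exists (d / (1 + d + nrm z) * c); split; first by rewrite mulr_gt0// divr_gt0.
move=> s s0; rewrite /= exprS big_cons mulrACA; apply: ler_pM.
- by rewrite mulr_ge0 ?divr_ge0 ?addr_ge0 ?nrm_ge0// ltW.
- by rewrite mulr_ge0 ?exprn_ge0 ?addr_ge0 ?nrm_ge0// ltW.
- rewrite mulrAC ler_pdivrMr//.
  have h1 : d <= nrm (s - z).
    apply: le_trans (nrm_ge_Re _); apply: le_trans (ler_norm _).
    by rewrite /d; move: s0; case: (s) (z) => a b [a' b'] /=; lra.
  have h2 : nrm s <= nrm (s - z) + nrm z by rewrite -{1}[s](subrK z) le_normcD.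
  have := nrm_ge0 z; move: h1 h2 d0; clearbody d; move: (nrm s) (nrm z) (nrm (s - z)) => a b e.
  nra.
- exact: cP.
Qed.

Lemma hurwitz_lower_root p n s : size p = n.+1 -> hurwitz p -> 0 < complex.Re s ->
  `|p`_n| * complex.Re s ^+ n <= nrm (polyval p s).
Proof.
move=> sp hp s0; have [r [rn pE]] := polyval_roots sp.
have r0 z : z \in r -> complex.Re z < 0.
  by move=> zr; apply: hp; rewrite pE (big_rem z)//= subrr mul0r mulr0.
rewrite pE Normc.normcM nrm_real ler_wpM2l//.
rewrite (big_morph nrm (@Normc.normcM R) (@Normc.normc1 R)) -rn.
elim: r r0 {rn pE} => [_|z r IH r0]; first by rewrite big_nil expr0.
rewrite big_cons exprS; apply: ler_pM; rewrite ?exprn_ge0 ?(ltW s0)//.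
  apply: le_trans (nrm_ge_Re _); apply: le_trans (ler_norm _).
  have : complex.Re z < 0 by apply: r0; rewrite mem_head.
  by case: (s) (z) => a b [a' b'] /=; lra.
by apply: IH => y yr; apply: r0; rewrite inE yr orbT.
Qed.

(** Connectedness of [0, 1]: the supremum of the points satisfying [Q] satisfies it too, and below 1
    it would have a larger such point next to it. *)
Lemma unit_interval_propagation (Q : R -> Prop) : Q 0 ->
  (forall t, 0 <= t <= 1 -> exists2 d : R, 0 < d &
     forall t', 0 <= t' <= 1 -> `|t' - t| < d -> (Q t <-> Q t')) -> Q 1.
Proof.
move=> Q0 H; pose S := [set t : R | 0 <= t <= 1 /\ Q t].
have S0 : S 0 by split=> //; rewrite lexx ler01.
have S1 t : S t -> t <= 1 by case=> /andP[].
have hS : has_sup S by split; [exists 0 | exists 1].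
have c01 : 0 <= sup S <= 1.
  by apply/andP; split; [apply: ub_le_sup => //; case: hS | apply: ge_sup => //; exists 0].
have [d d0 dP] := H _ c01.
have [t [t01 Qt] tc] := sup_adherent d0 hS.
have tS : t <= sup S by apply: ub_le_sup; [case: hS | split].
have Qc : Q (sup S) by apply/(dP t t01) => //; rewrite ler0_norm; lra.
have [<-//|c1] := eqVneq (sup S) 1.
have {}c1 : sup S < 1 by rewrite lt_neqAle c1; case/andP: c01.
pose t' := Num.min 1 (sup S + d / 2).
have t'1 : sup S < t' by rewrite lt_min c1 /=; lra.
have t'd : t' <= sup S + d / 2 by rewrite ge_min lexx orbT.
have t'01 : 0 <= t' <= 1.
  by case/andP: c01 => h _; rewrite ge_min lexx /= andbT; lra.
have : t' <= sup S.
  apply: ub_le_sup; first by case: hS.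
  by split=> //; apply/(dP t' t'01) => //; rewrite ger0_norm; lra.
by rewrite leNgt t'1.
Qed.

(* Hurwitz polynomials of fixed degree are open by the lower bound
   [c * (1 + |s|)^n] on the right half-plane, and closed among those without
   imaginary roots since a root [s] of the limit with [Re s > 0] would be at
   distance at least [Re s] of every root of its Hurwitz neighbours. *)
Lemma hurwitz_homotopy (p : R -> {poly R}) (n : nat) :
  (forall k, continuous (fun t => (p t)`_k)) ->
  (forall t, 0 <= t <= 1 -> size (p t) = n.+1) ->
  (forall t, 0 <= t <= 1 -> forall w : R, polyval (p t) (0 +i* w) != 0) ->
  hurwitz (p 0) -> hurwitz (p 1).
Proof.
move=> cont sz axis h0; apply: (@unit_interval_propagation (fun t => hurwitz (p t)) h0) => t t01.
have near_coef (eps : R) : 0 < eps -> exists2 d : R, 0 < d & forall t' : R,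
    `|t' - t| < d -> forall k : 'I_n.+1, `|(p t)`_k - (p t')`_k| <= eps.
  move=> e0; have : \forall t' \near t, forall k : 'I_n.+1, `|(p t)`_k - (p t')`_k| <= eps.
    apply: (filter_forall (F := nbhs t)) => k.
    exact: (cvgr_dist_le _ _ (cont k t) _ e0).
  move=> /nbhs_ballP[d /= d0 dP]; exists d => // t' h.
  by apply: dP; rewrite /ball /= distrC.
have s1 := sz t t01.
have nn : 0 < n.+1%:R :> R by rewrite ltr0n.
have [ht|ht] := pselect (hurwitz (p t)).
  have [c [c0 cP]] := hurwitz_lower s1 ht.
  (* The deviation is then at most half of the lower bound [c * (1 + |s|)^n]. *)
  have e0 : 0 < c / n.+1%:R / 2 by rewrite !divr_gt0.
  have [d d0 dP] := near_coef _ e0.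
  exists d => // t' t'01 h; split=> // _ s sE; rewrite ltNge; apply/negP => s0.
  have := polyval_dist s _ _ (dP t' h); rewrite s1 (sz _ t'01) => /(_ (leqnn _) (leqnn _)).
  rewrite sE subr0 => h2; have := le_trans (cP s s0) h2.
  have -> : n.+1%:R * (c / n.+1%:R / 2) = c / 2 by field; rewrite gt_eqF.
  have : 0 < (1 + nrm s) ^+ n by rewrite exprn_gt0// ltr_wpDr ?nrm_ge0.
  move: ((1 + nrm s) ^+ n) => X X0 hX.
  have cX : 0 < c * X by rewrite mulr_gt0.
  clear h2; lra.
have [s [s0 sE]] : exists s, 0 < complex.Re s /\ polyval (p t) s = 0.
  apply: contrapT => H; apply: ht => s sE; rewrite ltNge; apply/negP => s0.
  apply: H; exists s; split=> //; rewrite lt_def s0 andbT; apply/eqP => s00.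
  have sI : s = 0 +i* complex.Im s by move: s00; case: (s) => a b /= ->.
  by have := axis t t01 (complex.Im s); rewrite -sI sE eqxx.
pose a := `|(p t)`_n|.
have a0 : 0 < a.
  rewrite normr_gt0; have : lead_coef (p t) != 0 by rewrite lead_coef_eq0 -size_poly_eq0 s1.
  by rewrite lead_coefE s1.
pose X := complex.Re s ^+ n; have X0 : 0 < X by rewrite exprn_gt0.
pose Y := (1 + nrm s) ^+ n; have Y0 : 0 < Y by rewrite exprn_gt0// ltr_wpDr ?nrm_ge0.
(* The first bound keeps the neighbour's leading coefficient at least [a / 2], hence its value at
   [s] at least [a * X / 2]; the second keeps that value at most [a * X / 4]. *)
pose eps := Num.min (a / 2) (a * X / (4 * n.+1%:R * Y)).
have e0 : 0 < eps by rewrite lt_min !divr_gt0 ?mulr_gt0.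
have [d d0 dP] := near_coef _ e0; exists d => // t' t'01 h; split=> [/ht//|ht'].
have := polyval_dist s _ _ (dP t' h); rewrite s1 (sz _ t'01) => /(_ (leqnn _) (leqnn _)).
rewrite sE sub0r normcN -/Y => h2.
have := hurwitz_lower_root (sz _ t'01) ht' s0; rewrite -/X => h3.
have h4 : a / 2 <= `|(p t')`_n|.
  have := dP t' h ord_max; rewrite /= => h5.
  have h6 : a <= `|(p t')`_n| + `|(p t)`_n - (p t')`_n|.
    by rewrite /a -{1}[(p t)`_n](subrK (p t')`_n) addrC ler_normD.
  have : eps <= a / 2 by rewrite ge_min lexx.
  lra.
have h7 : n.+1%:R * eps * Y <= a * X / 4.
  have : eps <= a * X / (4 * n.+1%:R * Y) by rewrite ge_min lexx orbT.
  rewrite ler_pdivlMr ?mulr_gt0// => h8.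
  rewrite ler_pdivlMr//; apply: le_trans h8; rewrite le_eqVlt; apply/orP; left; apply/eqP; ring.
have h9 : a / 2 * X <= `|(p t')`_n| * X by rewrite ler_pM2r.
have : 0 < a * X by rewrite mulr_gt0.
have := le_trans h9 (le_trans h3 (le_trans h2 h7)).
lra.
Qed.

End Hurwitz.

(** * Rational functions *)

Section RationalFunctions.
Variable R : realType.
Local Notation C := R[i].
Local Notation ratfun := {fraction {poly R}}.
Local Notation tofrac := (@FracField.tofrac {poly R}).
Implicit Types (f : ratfun) (p q : {poly R}) (s : C).

Lemma frac_reprE f : f * tofrac (frac (repr f)).2 = tofrac (frac (repr f)).1.
Proof.
rewrite -{1}[f]reprK; move: (repr f) => x; apply/eqP.
have d0 : x.2 * 1 != 0 by rewrite mulr1 denom_ratioP.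
by rewrite !piE /FracField.equivf /FracField.mulf !numden_Ratio ?oner_eq0// !mulr1 mulrC.
Qed.

Lemma rat_num_denP f :
  [/\ f * tofrac (rat_den f) = tofrac (rat_num f), rat_den f != 0
    & coprimep (rat_num f) (rat_den f)].
Proof.
have := frac_reprE f; rewrite /rat_num /rat_den; have := denom_ratioP (repr f).
case: (frac (repr f)) => a b /= b0 E.
have g0 : gcdp a b != 0 by rewrite gcdp_eq0 negb_and b0 orbT.
have aE : a = a %/ gcdp a b * gcdp a b by rewrite divpK// dvdp_gcdl.
have bE : b = b %/ gcdp a b * gcdp a b by rewrite divpK// dvdp_gcdr.
split; last by rewrite coprimep_div_gcd// b0 orbT.
  have g0' : tofrac (gcdp a b) != 0 by rewrite tofrac_eq0.
  by apply: (mulIf g0'); rewrite -mulrA -!tofracM -aE -bE.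
by apply: contra_neq b0 => b0; rewrite bE b0 mul0r.
Qed.

Lemma frac_lowest f p q : q != 0 -> f * tofrac q = tofrac p ->
  exists c, [/\ c != 0, p = c * rat_num f & q = c * rat_den f].
Proof.
move=> q0 E; have [fE d0 cop] := rat_num_denP f.
have cross : p * rat_den f = q * rat_num f.
  apply/eqP; rewrite -tofrac_eq !tofracM -E -fE; apply/eqP; ring.
have : rat_den f %| q.
  have cop' : coprimep (rat_den f) (rat_num f) by rewrite coprimep_sym.
  by rewrite -(Gauss_dvdpl q cop') -cross dvdp_mull.
rewrite dvdp_eq => /eqP; set c := _ %/ _ => qE; exists c; split=> //.
  by apply: contra_neq q0 => c0; rewrite qE c0 mul0r.
by apply: (mulIf d0); rewrite cross {1}qE; ring.
Qed.

Lemma polyvalM p q s : polyval (p * q) s = polyval p s * polyval q s.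
Proof. by rewrite /polyval rmorphM hornerM. Qed.

Lemma polyval_conj p s : polyval p (conjc s) = conjc (polyval p s).
Proof.
rewrite (polyvalE _ (leqnn _)) [in RHS](polyvalE _ (leqnn _)) (rmorph_sum (@conjc R)).
apply: eq_bigr => k _; rewrite rmorphM rmorphXn; congr (_ * _).
by rewrite /= oppr0.
Qed.

Lemma hurwitz_neq0 p : hurwitz p -> p != 0.
Proof.
move=> H; apply/eqP => p0; have := H 0; rewrite p0 /polyval map_poly0 horner0 => /(_ erefl).
by rewrite /= ltxx.
Qed.

(** Any representation will do: cancelling a common factor only removes roots of the denominator and
    lowers both degrees equally. *)
Lemma proper_stable_frac f p q : f * tofrac q = tofrac p -> hurwitz q ->
  (size p <= size q)%N -> Defs.proper f /\ Defs.stable f.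
Proof.
move=> E hq spq; have [c [c0 pE qE]] := frac_lowest (hurwitz_neq0 hq) E.
have [_ d0 _] := rat_num_denP f.
split; last by move=> s sE; apply: hq; rewrite qE polyvalM sE mulr0.
rewrite /Defs.proper; have [->|n0] := eqVneq (rat_num f) 0; first by rewrite size_poly0.
move: spq; rewrite pE qE !size_mul//.
have : (0 < size c)%N by rewrite size_poly_gt0.
move: (size c) (size (rat_num f)) (size (rat_den f)) => [//|a] b d _.
by rewrite !addSn /= leq_add2l.
Qed.

Lemma ratval_frac f p q s : f * tofrac q = tofrac p -> polyval q s != 0 ->
  ratval f s = polyval p s / polyval q s.
Proof.
move=> E qs; have q0 : q != 0.
  by apply: contra_neq qs => ->; rewrite /polyval map_poly0 horner0.
have [c [c0 pE qE]] := frac_lowest q0 E.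
move: qs; rewrite /ratval qE pE !polyvalM mulf_eq0 negb_or => /andP[cs ds].
by field; rewrite cs ds.
Qed.

Lemma proper_stable_common (I : finType) (F : I -> ratfun) :
  (forall i, Defs.proper (F i) /\ Defs.stable (F i)) ->
  exists (d : {poly R}) (n : I -> {poly R}), hurwitz d /\ forall i,
    F i * tofrac d = tofrac (n i) /\ (size (n i) <= size d)%N.
Proof.
move=> H; pose d := \prod_i rat_den (F i).
have d0 : d != 0 by apply/prodf_neq0 => i _; have [] := rat_num_denP (F i).
exists d, (fun i => rat_num (F i) * \prod_(j | j != i) rat_den (F j)); split.
  move=> s; rewrite /polyval rmorph_prod horner_prod => /eqP/prodf_eq0[i _ /eqP].
  by have [_] := H i; apply.
move=> i; have [E di0 _] := rat_num_denP (F i).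
have dE : d = rat_den (F i) * \prod_(j | j != i) rat_den (F j) by rewrite /d (bigD1 i).
split; first by rewrite dE !tofracM mulrA E.
have [->|n0] := eqVneq (rat_num (F i)) 0; first by rewrite mul0r size_poly0.
have r0 : \prod_(j | j != i) rat_den (F j) != 0.
  by apply: contra_neq d0 => E0; rewrite dE E0 mulr0.
by have [pr _] := H i; rewrite dE !size_mul// -!subn1 leq_sub2r// leq_add2r.
Qed.

Lemma imag_inv_cvg0 : ((fun r : R => ((0 +i* r)^-1 : C^o)) @ +oo --> (0 : C^o))%classic.
Proof.
apply/cvgr0Pnorm_lt => e e0.
have [er eE] : exists r : R, e = r%:C.
  by move/gtr0_real: e0 => /complex_realP.
rewrite eE in e0 *; have {}e0 : 0 < er by move: e0; rewrite ltcR.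
near=> r; have r0 : 0 < r by near: r; apply: nbhs_pinfty_gt; rewrite num_real.
rewrite normfV normc_def /= expr0n add0r sqrtr_sqr ger0_norm ?ltW//.
rewrite -fmorphV ltcR invf_plt//.
by near: r; apply: nbhs_pinfty_gt; rewrite num_real.
Unshelve. all: by end_near. Qed.

Lemma horner_cvg0 (p : {poly C}) (h : R -> C^o) :
  (h @ +oo --> (0 : C^o))%classic -> ((fun r => p.[h r] : C^o) @ +oo --> (p.[0] : C^o))%classic.
Proof.
move=> h0; elim/poly_ind: p => [|p c IH].
  rewrite horner0; under eq_fun do rewrite horner0; exact: cvg_cst.
rewrite hornerMXaddC; under eq_fun do rewrite hornerMXaddC.
have IHM := cvgM IH h0.
exact: cvgD (IHM _) (cvg_cst (c : C^o)).
Qed.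

(** The reversed polynomial z^n p(1/z), which turns a limit at infinity into a value at 0. *)
Definition rev_poly (n : nat) (p : {poly C}) : {poly C} := \poly_(k < n.+1) p`_(n - k).

Lemma rev_polyE n (p : {poly C}) (z : C) : (size p <= n.+1)%N -> z != 0 ->
  p.[z] = z ^+ n * (rev_poly n p).[z^-1].
Proof.
move=> sp z0; rewrite horner_poly (horner_coef_wide _ sp) mulr_sumr.
rewrite (reindex_inj rev_ord_inj) /=; apply: eq_bigr => k _.
rewrite subSS mulrCA; congr (_ * _).
have kn : (k <= n)%N by rewrite -ltnS.
have -> : z ^+ n = z ^+ (n - k) * z ^+ k by rewrite -exprD subnK.
by rewrite -mulrA exprVn divff ?mulr1// expf_neq0.
Qed.

Lemma freqval_infty f p q n : f * tofrac q = tofrac p -> hurwitz q ->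
  size q = n.+1 -> (size p <= n.+1)%N ->
  freqval f +oo%E = (p`_n)%:C / (q`_n)%:C.
Proof.
move=> E hq sq sp.
have lc : q`_n != 0.
  have : lead_coef q != 0 by rewrite lead_coef_eq0 -size_poly_eq0 sq.
  by rewrite lead_coefE sq.
pose P := rev_poly n (map_poly (real_complex R) p).
pose Q := rev_poly n (map_poly (real_complex R) q).
have PE : P.[0] = (p`_n)%:C by rewrite horner_coef0 coef_poly subn0 coef_map.
have QE : Q.[0] = (q`_n)%:C by rewrite horner_coef0 coef_poly subn0 coef_map.
rewrite /freqval -PE -QE.
suff H : ((fun r : R => (ratval f (0 +i* r) : C^o)) @ +oo --> (P.[0] / Q.[0] : C^o))%classic.
  exact: (cvg_lim (@norm_hausdorff _ (C^o)) H).
have axis r : polyval q (0 +i* r) != 0.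
  by apply/eqP => /hq /=; rewrite ltxx.
apply: (@cvg_trans _ ((fun r : R => (P.[(0 +i* r)^-1] / Q.[(0 +i* r)^-1] : C^o)) @ +oo)%classic).
  apply: near_eq_cvg; near=> r.
  have r0 : 0 < r by near: r; apply: nbhs_pinfty_gt; rewrite num_real.
  have i0 : 0 +i* r != 0 :> C by rewrite eq_complex /= eqxx (gt_eqF r0).
  rewrite (ratval_frac E (axis r)) /polyval !(@rev_polyE n _ (0 +i* r))// ?size_map_poly// ?sq//.
  by rewrite invfM mulrACA divff ?mul1r// expf_neq0.
apply: cvgM; first exact: horner_cvg0 imag_inv_cvg0.
apply: cvgV; last exact: horner_cvg0 imag_inv_cvg0.
by rewrite QE fmorph_eq0.
Unshelve. all: by end_near. Qed.

End RationalFunctions.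

(** * The return difference as a polynomial matrix *)

Section NetworkMatrix.
Variables (S : comNzRingType) (N m : nat).

(* Block form of [delta%:M - (B (x) 1) * diag Nn]. *)
Definition network_mx (delta : S) (B : 'M[S]_N) (Nn : 'I_N -> 'M[S]_m) : 'M[S]_(N * m) :=
  \matrix_(x, y) (delta *+ (x == y) -
    B (mxtens_unindex x).1 (mxtens_unindex y).1 *
    Nn (mxtens_unindex y).1 (mxtens_unindex x).2 (mxtens_unindex y).2).

End NetworkMatrix.

Lemma map_network_mx (S S' : comNzRingType) (phi : {rmorphism S -> S'}) (N m : nat)
    (delta : S) (B : 'M[S]_N) (Nn : 'I_N -> 'M[S]_m) :
  map_mx phi (network_mx delta B Nn) =
  network_mx (phi delta) (map_mx phi B) (fun i => map_mx phi (Nn i)).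
Proof. by apply/matrixP => x y; rewrite !mxE rmorphB rmorphM rmorphMn. Qed.

(** The blocks of a kernel vector solve the loop equations with vertex matrices [Nn j / delta]. *)
Lemma network_mx_det (F : fieldType) (N m : nat) (delta : F) (B : 'M[F]_N)
    (Nn : 'I_N -> 'M[F]_m) : delta != 0 ->
  (forall f : 'I_N -> 'cV[F]_m,
     (forall k, f k = \sum_j B k j *: ((delta^-1 *: Nn j) *m f j)) ->
     forall k, f k = 0) ->
  \det (network_mx delta B Nn) != 0.
Proof.
move=> d0 ker; rewrite -unitfE -unitmxE; apply: unitmx_kernel => u Xu.
have I1 p : Ordinal (mxtens_index_proof1 (@mxtens_index N m p)) = p.1 :=
  congr1 fst (mxtens_indexK p).
have I2 p : Ordinal (mxtens_index_proof2 (@mxtens_index N m p)) = p.2 :=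
  congr1 snd (mxtens_indexK p).
pose f j : 'cV[F]_m := \col_b u (mxtens_index (j, b)) ord0.
have f0 : forall k, f k = 0.
  apply: ker => k; apply/matrixP => a z; rewrite (ord1 z) {z}.
  move/matrixP: Xu => /(_ (mxtens_index (k, a)) ord0); rewrite !mxE.
  under eq_bigr do rewrite mxE mulrBl.
  rewrite sumrB (bigD1 (mxtens_index (k, a)))//= eqxx mulr1n big1 ?addr0; last first.
    by move=> y yk; rewrite eq_sym (negPf yk) mulr0n mul0r.
  move/eqP; rewrite subr_eq0 => /eqP E.
  apply: (mulfI d0); rewrite E summxE mulr_sumr.
  rewrite (reindex (@mxtens_index N m)); last first.
    by exists (@mxtens_unindex N m) => y _; rewrite ?mxtens_indexK ?mxtens_unindexK.
  transitivity (\sum_(p : 'I_N * 'I_m) B k p.1 * Nn p.1 a p.2 * u (mxtens_index p) ord0).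
    by apply: eq_bigr => -[j b] _; rewrite !I1 !I2 (I1 (k, a)) (I2 (k, a)).
  transitivity (\sum_j \sum_b B k j * Nn j a b * u (mxtens_index (j, b)) ord0).
    by rewrite pair_bigA; apply: eq_bigr => -[j b] _.
  apply: eq_bigr => j _; rewrite !mxE !mulr_sumr; apply: eq_bigr => b _.
  rewrite !mxE mulrCA -mulrA; congr (_ * _).
  by rewrite !mulrA divff// mul1r.
apply/matrixP => x z; rewrite (ord1 z) mxE -[x]mxtens_unindexK.
by case: (mxtens_unindex x) => k a; have /matrixP/(_ a ord0) := f0 k; rewrite !mxE.
Qed.

(** * Top coefficients and degree bounds of determinants *)

Section TopCoefficient.
Variable S : comNzRingType.

Lemma top_coefM (p q : {poly S}) a b : (size p <= a.+1)%N -> (size q <= b.+1)%N ->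
  (size (p * q)%R <= (a + b).+1)%N /\ (p * q)`_(a + b)%N = p`_a * q`_b.
Proof.
move=> sp sq; split.
  by apply: leq_trans (size_polyMleq _ _) _; lia.
have ak : (a < (a + b).+1)%N by rewrite ltnS leq_addr.
rewrite coefM (bigD1 (Ordinal ak))//= addKn big1 ?addr0// => i /eqP ia.
have [lt|ge] := ltnP i a.
  by rewrite [q`_ _]nth_default ?mulr0//; apply: leq_trans sq _; lia.
have ai : (a < i)%N by rewrite ltn_neqAle ge andbT; apply/eqP => E; apply: ia; apply: val_inj.
by rewrite [p`_ _]nth_default ?mul0r// (leq_trans sp).
Qed.

Lemma top_coef_prod (I : Type) (r : seq I) (F : I -> {poly S}) d :
  (forall i, (size (F i) <= d.+1)%N) ->
  (size (\prod_(i <- r) F i)%R <= (size r * d).+1)%N /\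
  (\prod_(i <- r) F i)`_(size r * d)%N = \prod_(i <- r) (F i)`_d.
Proof.
move=> sF; elim: r => [|i r [IH1 IH2]]; first by rewrite !big_nil size_poly1 coef1.
by have [h1 h2] := top_coefM (sF i) IH1; rewrite !big_cons /= mulSn h2 IH2.
Qed.

(** Here [d] is only a bound, so top coefficients may vanish: the degree [n * d] is reached exactly
    when the matrix of coefficients of degree [d] has nonzero determinant. *)
Lemma top_coef_det n (X : 'M[{poly S}]_n) d : (forall i j, (size (X i j) <= d.+1)%N) ->
  (size (\det X) <= (n * d).+1)%N /\
  (\det X)`_(n * d)%N = \det (\matrix_(i, j) (X i j)`_d).
Proof.
move=> sX; have sI : size (index_enum 'I_n) = n.
  by rewrite [index_enum _]unlock -enumT size_enum_ord.
have H (s : 'I_n -> 'I_n) :=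
  @top_coef_prod _ (index_enum 'I_n) (fun i => X i (s i)) d (fun i => sX i (s i)).
split.
  apply: (leq_trans (size_sum _ _ _)); apply/bigmax_leqP => s _.
  have [] := H s; rewrite sI => h _.
  by case: (odd_perm s); rewrite ?expr1 ?mulN1r ?size_polyN ?expr0 ?mul1r.
rewrite /determinant coef_sum; apply: eq_bigr => s _.
have [_] := H s; rewrite sI => h.
have -> : \prod_i (\matrix_(i0, j) (X i0 j)`_d) i (s i) = (\prod_i X i (s i))`_(n * d)%N.
  by rewrite h; apply: eq_bigr => i _; rewrite mxE.
by case: (odd_perm s); rewrite ?expr1 ?mulN1r ?coefN ?expr0 ?mul1r.
Qed.

Lemma size_cofactor n (X : 'M[{poly S}]_n) d i j : (forall i j, (size (X i j) <= d.+1)%N) ->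
  (size (cofactor X i j) <= (n.-1 * d).+1)%N.
Proof.
move=> sX; rewrite /cofactor -signr_odd.
have [|h _] := @top_coef_det _ (row' i (col' j X)) d; first by move=> a b; rewrite !mxE.
by case: (odd _); rewrite ?expr1 ?mulN1r ?size_polyN ?expr0 ?mul1r.
Qed.

End TopCoefficient.

Section ContinuousCoefficients.
Variable R : realType.
Implicit Types F G : R -> {poly R}.

Definition coef_continuous F : Prop := forall k, continuous (fun t => (F t)`_k).

Lemma sum_continuous (I : Type) (r : seq I) (h : I -> R -> R) :
  (forall i, continuous (h i)) -> continuous (fun t => \sum_(i <- r) h i t).
Proof.
move=> H; elim: r => [|i r IH] t.
  by under eq_fun do rewrite big_nil; exact: cvg_cst.
under eq_fun do rewrite big_cons.
exact: cvgD (H i t) (IH t).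
Qed.

Lemma coef_continuous_const p : coef_continuous (fun=> p).
Proof. by move=> k t; exact: cvg_cst. Qed.

Lemma coef_continuousC (h : R -> R) : continuous h -> coef_continuous (fun t => (h t)%:P).
Proof.
move=> H k t; under eq_fun do rewrite coefC.
by case: eqP => _; [exact: H | exact: cvg_cst].
Qed.

Lemma coef_continuousD F G : coef_continuous F -> coef_continuous G ->
  coef_continuous (fun t => F t + G t).
Proof.
move=> HF HG k t; under eq_fun do rewrite coefD.
exact: cvgD (HF k t) (HG k t).
Qed.

Lemma coef_continuousN F : coef_continuous F -> coef_continuous (fun t => - F t).
Proof.
move=> HF k t; under eq_fun do rewrite coefN.
exact: cvgN (HF k t).
Qed.

Lemma coef_continuousM F G : coef_continuous F -> coef_continuous G ->
  coef_continuous (fun t => F t * G t).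
Proof.
move=> HF HG k; under eq_fun do rewrite coefM; apply: sum_continuous => i t.
exact: cvgM (HF i t) (HG _ t).
Qed.

Lemma coef_continuous_sum (I : Type) (r : seq I) (F : I -> R -> {poly R}) :
  (forall i, coef_continuous (F i)) -> coef_continuous (fun t => \sum_(i <- r) F i t).
Proof.
move=> H k; under eq_fun do rewrite coef_sum; apply: sum_continuous => i; exact: H.
Qed.

Lemma coef_continuous_prod (I : Type) (r : seq I) (F : I -> R -> {poly R}) :
  (forall i, coef_continuous (F i)) -> coef_continuous (fun t => \prod_(i <- r) F i t).
Proof.
move=> H; elim: r => [|i r IH].
  by under eq_fun do rewrite big_nil; exact: coef_continuous_const.
by under eq_fun do rewrite big_cons; exact: coef_continuousM.
Qed.

Lemma coef_continuous_det n (X : R -> 'M[{poly R}]_n) :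
  (forall i j, coef_continuous (fun t => X t i j)) ->
  coef_continuous (fun t => \det (X t)).
Proof.
move=> H; apply: coef_continuous_sum => s.
by apply: coef_continuousM; [exact: coef_continuous_const | exact: coef_continuous_prod].
Qed.

End ContinuousCoefficients.

(** * The homotopy of the network and its stability *)

Section Assembly.
Variables (R : realType) (N m l : nat) (e : rel 'I_N) (loop : 'I_l.+1 -> seq 'I_N).
Variables (A : 'M[R]_N) (P : 'I_N -> 'M[{fraction {poly R}}]_m).
Hypotheses (sun : sunflower e loop) (adj : signed_adjacency e A).
Variables (d : {poly R}) (n : 'I_N -> 'M[{poly R}]_m).
Hypotheses (d_hurwitz : hurwitz d)
  (Pfrac : forall i a b, P i a b * FracField.tofrac d = FracField.tofrac (n i a b))
  (n_size : forall i a b, (size (n i a b) <= size d)%N).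
Local Notation C := R[i].
Local Notation tofrac := (@FracField.tofrac {poly R}).

Definition pencil (B : 'M[R]_N) : 'M[{poly R}]_(N * m) :=
  network_mx d (map_mx polyC B) n.

Lemma return_difference_pencil :
  tofrac d *: return_difference A P = map_mx tofrac (pencil A).
Proof.
rewrite map_network_mx /return_difference mulmx_sumr.
under eq_bigr do rewrite tensmx_mul mul1mx.
set Ac := map_mx _ A.
have K k i j : (- Ac *m delta_mx i i) k j = - tofrac (A k i)%:P *+ (j == i).
  rewrite mxE (bigD1 i) // big1 => [|h hi].
    by rewrite !mxE eqxx /= addr0 mulr_natr.
  by rewrite !mxE (negPf hi) /= mulr0.
apply/matrixP => x y; rewrite -[x]mxtens_unindexK -[y]mxtens_unindexK.
case: (mxtens_unindex x) (mxtens_unindex y) => k a [j b].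
rewrite [LHS]mxE [X in _ * X]mxE summxE (bigD1 j)// big1 => [|i ij]; last first.
  by rewrite tensmxE K eq_sym (negPf ij) mulr0n mul0r.
rewrite tensmxE K eqxx mulr1n /= addr0 [RHS]mxE !mxtens_indexK !mxE -Pfrac mulrDr mulr_natr.
by congr (_ + _); ring.
Qed.

Lemma polyval_pencil B s : polyval (\det (pencil B)) s =
  \det (network_mx (polyval d s) (map_mx (real_complex R) B)
                   (fun i => map_mx (fun p => polyval p s) (n i))).
Proof.
pose phi : {rmorphism {poly R} -> C} := horner_eval s \o map_poly (real_complex R).
rewrite -[polyval _ s]/(phi _) -det_map_mx map_network_mx -map_mx_comp.
congr (\det (network_mx _ _ _)).
by apply/matrixP => i j; rewrite !mxE /= map_polyC /horner_eval hornerC.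
Qed.

Lemma size_pencil B x y : (size (pencil B x y) <= (size d).-1.+1)%N.
Proof.
have d0 : (0 < size d)%N by rewrite size_poly_gt0 hurwitz_neq0.
rewrite prednK// !mxE; apply: leq_trans (size_polyD _ _) _.
rewrite geq_max size_polyN; apply/andP; split.
  by case: eqP => _; rewrite ?mulr1n// mulr0n size_poly0.
by rewrite mul_polyC; apply: leq_trans (size_scale_leq _ _) (n_size _ _ _).
Qed.

Lemma top_pencil B : (\det (pencil B))`_(N * m * (size d).-1)%N =
  \det (network_mx (lead_coef d) B (fun i => \matrix_(a, b) (n i a b)`_(size d).-1)).
Proof.
have [_ ->] := top_coef_det (size_pencil B); congr (\det _).
apply/matrixP => x y; rewrite !mxE coefB coefMn coefCM lead_coefE.
by [].
Qed.

Definition freq (w : \bar R) (i : 'I_N) : 'M[C]_m := freqresp (P i) w.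

Lemma freq_fin (w : R) i : freq w%:E i =
  (polyval d (0 +i* w))^-1 *: map_mx (fun p => polyval p (0 +i* w)) (n i).
Proof.
have dw : polyval d (0 +i* w) != 0 by apply/eqP => /d_hurwitz /=; rewrite ltxx.
by apply/matrixP => a b; rewrite !mxE /= (ratval_frac (Pfrac i a b) dw) mulrC.
Qed.

Lemma freq_infty i : freq +oo%E i =
  ((lead_coef d)%:C)^-1 *: map_mx (real_complex R) (\matrix_(a, b) (n i a b)`_(size d).-1).
Proof.
have d0 : (0 < size d)%N by rewrite size_poly_gt0 hurwitz_neq0.
apply/matrixP => a b; rewrite !mxE.
rewrite (@freqval_infty _ _ _ _ (size d).-1 (Pfrac i a b)) ?prednK//; last first.
by rewrite mulrC lead_coefE.
Qed.

Local Notation sadj := (scaled_adjacency loop A).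

Definition well_posed (M : 'I_N -> 'M[C]_m) (sigma tau : R) : Prop :=
  forall f : 'I_N -> 'cV[C]_m,
    (forall k, f k = \sum_j (sadj sigma tau k j)%:C *: (M j *m f j)) -> forall k, f k = 0.

Lemma pencil_neq0 sigma tau s : polyval d s != 0 ->
  well_posed (fun i => (polyval d s)^-1 *: map_mx (fun p => polyval p s) (n i)) sigma tau ->
  polyval (\det (pencil (sadj sigma tau))) s != 0.
Proof.
move=> ds wp; rewrite polyval_pencil; apply: network_mx_det => // f fE; apply: wp => k.
by rewrite fE; apply: eq_bigr => j _; rewrite [in LHS]mxE.
Qed.

Lemma pencil_axis sigma tau :
  (forall w : \bar R, (0 <= w)%E -> well_posed (freq w) sigma tau) ->
  forall w : R, polyval (\det (pencil (sadj sigma tau))) (0 +i* w) != 0.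
Proof.
move=> wp.
have pos (w : R) : 0 <= w -> polyval (\det (pencil (sadj sigma tau))) (0 +i* w) != 0.
  move=> w0; apply: pencil_neq0; first by apply/eqP => /d_hurwitz /=; rewrite ltxx.
  have -> : (fun i => (polyval d (0 +i* w))^-1 *:
      map_mx (fun p => polyval p (0 +i* w)) (n i)) = freq w%:E.
    by apply: funext => i; rewrite freq_fin.
  by apply: wp; rewrite lee_fin.
move=> w; have [/pos//|w0] := leP 0 w.
(* Negative frequencies follow by conjugation, the coefficients being real. *)
have -> : 0 +i* w = conjc (0 +i* (- w)) :> C by rewrite /= opprK.
by rewrite polyval_conj conjc_eq0 pos// oppr_ge0 ltW.
Qed.

(** The top coefficient is, up to the nonzero scaling by [lead_coef d], the determinant of the loop
    equations at +oo. *)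
Lemma pencil_size sigma tau : well_posed (freq +oo%E) sigma tau ->
  size (\det (pencil (sadj sigma tau))) = (N * m * (size d).-1).+1.
Proof.
move=> wp; have [h _] := top_coef_det (size_pencil (sadj sigma tau)).
apply/eqP; rewrite eqn_leq h ltnNge /=.
suff: (\det (pencil (sadj sigma tau)))`_(N * m * (size d).-1)%N != 0.
  by apply: contra_neqN => /leq_sizeP; apply.
rewrite top_pencil.
rewrite -(fmorph_eq0 (real_complex R)) -det_map_mx map_network_mx.
apply: network_mx_det.
  by rewrite fmorph_eq0 lead_coef_eq0 hurwitz_neq0.
move=> f fE; apply: wp => k; rewrite fE; apply: eq_bigr => j _.
by rewrite [in LHS]mxE freq_infty.
Qed.

(** With every loop cut the kernel is trivial at each [s] that is not a root of [d], in particular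
    on the closed right half-plane. *)
Lemma pencil_hurwitz0 : hurwitz (\det (pencil (sadj 0 0))).
Proof.
move=> s /eqP; apply: contraTT; rewrite -leNgt => s0; apply: pencil_neq0.
  by apply/eqP => /d_hurwitz; rewrite ltNge s0.
move=> f fE; apply: (scaled_kernel sun adj _ _ fE) => [i _ u|c]; by rewrite scale0r addr0.
Qed.

Lemma sadj_continuous (s t : R -> R) k j : continuous s -> continuous t ->
  continuous (fun x => sadj (s x) (t x) k j).
Proof.
move=> cs ct; rewrite (_ : (fun x => _) = fun x => if A k j == -1 then
    if (k \in loop ord0) && (j == prev (loop ord0) k) then - t x else - s x
  else A k j); last by apply: funext => x; rewrite mxE.
case: (A k j == -1); last by move=> x; exact: cvg_cst.
by case: (_ && _) => x; apply: cvgN; [exact: ct | exact: cs].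
Qed.

Lemma pencil_continuous (s t : R -> R) : continuous s -> continuous t ->
  coef_continuous (fun x => \det (pencil (sadj (s x) (t x)))).
Proof.
move=> cs ct; apply: coef_continuous_det => i j.
rewrite (_ : (fun x => _) = fun x => d *+ (i == j) -
  (sadj (s x) (t x) (mxtens_unindex i).1 (mxtens_unindex j).1)%:P *
  n (mxtens_unindex j).1 (mxtens_unindex i).2 (mxtens_unindex j).2); last first.
  by apply: funext => x; rewrite !mxE.
apply: coef_continuousD; first exact: coef_continuous_const.
apply: coef_continuousN; apply: coef_continuousM; last exact: coef_continuous_const.
by apply: coef_continuousC; apply: sadj_continuous.
Qed.

Lemma pencil_hurwitz :
  (forall (w : \bar R) (sigma : R), (0 <= w)%E -> 0 <= sigma <= 1 -> well_posed (freq w) sigma 0) ->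
  (forall (w : \bar R) (tau : R), (0 <= w)%E -> 0 <= tau <= 1 -> well_posed (freq w) 1 tau) ->
  hurwitz (\det (pencil A)).
Proof.
move=> wp1 wp2; rewrite -(scaled_adjacency1 loop A).
have id_cont : continuous (fun x : R => x) by move=> x; exact: cvg_id.
have cst_cont (c : R) : continuous (fun _ : R => c) by move=> x; exact: cvg_cst.
have h1 : hurwitz (\det (pencil (sadj 1 0))).
  apply: (@hurwitz_homotopy _ (fun t => \det (pencil (sadj t 0))) (N * m * (size d).-1)).
  - exact: pencil_continuous.
  - by move=> t t01; apply/pencil_size/wp1.
  - by move=> t t01; apply: pencil_axis => w w0; apply: wp1.
  - exact: pencil_hurwitz0.
apply: (@hurwitz_homotopy _ (fun t => \det (pencil (sadj 1 t))) (N * m * (size d).-1)) => //.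
- exact: pencil_continuous.
- by move=> t t01; apply/pencil_size/wp2.
- by move=> t t01; apply: pencil_axis => w w0; apply: wp2.
Qed.

Lemma network_stable_pencil : hurwitz (\det (pencil A)) ->
  size (\det (pencil A)) = (N * m * (size d).-1).+1 -> network_stable A P.
Proof.
move=> hp sp; have E := return_difference_pencil.
have d0 : tofrac d != 0 by rewrite tofrac_eq0 hurwitz_neq0.
have p0 : tofrac (\det (pencil A)) != 0 by rewrite tofrac_eq0 hurwitz_neq0.
have uG : return_difference A P \in unitmx.
  rewrite unitmxE unitfE; apply: contra_neq p0 => G0.
  by rewrite -det_map_mx -E detZ G0 mulr0.
split=> // x y.
have invE : invmx (return_difference A P) x y * tofrac (\det (pencil A)) =
    tofrac (d * (\adj (pencil A)) x y).
  have : return_difference A P *m map_mx tofrac (d *: \adj (pencil A)) =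
         (tofrac (\det (pencil A)))%:M.
    rewrite map_mxZ -scalemxAr scalemxAl E -map_mxM mul_mx_adj.
    by rewrite map_scalar_mx.
  move/(congr1 (mulmx (invmx (return_difference A P)))); rewrite mulKmx// mul_mx_scalar.
  by move/matrixP/(_ x y); rewrite [LHS]mxE [X in tofrac X = _]mxE [RHS]mxE => ->; rewrite mulrC.
apply: (proper_stable_frac invE hp).
rewrite sp !mxE; apply: leq_trans (size_polyMleq _ _) _.
have d1 : (0 < size d)%N by rewrite size_poly_gt0 hurwitz_neq0.
have Nm : (0 < N * m)%N := leq_ltn_trans (leq0n _) (ltn_ord x).
(* Properness: a cofactor has degree at most [N * m - 1] times that of [d], so its product with [d]
   does not exceed the degree of the determinant. *)
have -> : (N * m * (size d).-1 = (size d).-1 + (N * m).-1 * (size d).-1)%N.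
  by rewrite -mulSn prednK.
rewrite -{1}(prednK d1) addSn /= -addnS leq_add2l.
exact: size_cofactor (size_pencil A).
Qed.

End Assembly.

Theorem theorem8 (R : realType) (N m l : nat)
    (e : rel 'I_N) (loop : 'I_l.+1 -> seq 'I_N) (A : 'M[R]_N)
    (P : 'I_N -> 'M[{fraction {poly R}}]_m)
    (graph_sunflower : sunflower e loop)
    (adjacency : signed_adjacency e A)
    (P_RHinf : forall i, RHinf (P i)) :
  (exists (xi eta theta : 'I_N -> \bar R -> R)
          (PP : 'I_N -> \bar R -> set 'M[R[i]]_m),
     (forall (i : 'I_N) (w : \bar R), i \in hubs loop -> (0 <= w)%E ->
        forall q, q \in petals_at loop i ->
          theta i w = \sum_(k in loop_vertices loop q) xi k w) /\
     (forall w : \bar R, (0 <= w)%E ->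
        let xiw := fun k => xi k w in
        let etaw := fun i => eta i w in
        let thetaw := fun i => theta i w in
        let PPw := fun i => PP i w in
        [/\ admissible loop xiw etaw (fun i => freqresp (P i) w) PPw,
            forall i, i \in hubs loop ->
              @half_line R `&` petal_region loop xiw thetaw PPw i = set0
          & @half_line R `&` central_region loop xiw etaw thetaw PPw = set0])) ->
  network_stable A P.
Proof.
move=> [xi [eta [theta [PP [thetaE cond]]]]].
have [d [n [d_hurwitz dn]]] : exists d (n : ('I_N * 'I_m * 'I_m) -> {poly R}),
    hurwitz d /\ forall i, P i.1.1 i.1.2 i.2 * FracField.tofrac d = FracField.tofrac (n i) /\
      (size (n i) <= size d)%N.
  by apply: proper_stable_common => i; apply: P_RHinf.
pose n' i : 'M[{poly R}]_m := \matrix_(a, b) n (i, a, b).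
have Pfrac i a b : P i a b * FracField.tofrac d = FracField.tofrac (n' i a b).
  by rewrite mxE; have [] := dn (i, a, b).
have n_size i a b : (size (n' i a b) <= size d)%N.
  by rewrite mxE; have [] := dn (i, a, b).
have wp1 (w : \bar R) (sigma : R) : (0 <= w)%E -> 0 <= sigma <= 1 ->
    well_posed loop A (freq P w) sigma 0.
  move=> w0 s01 f fE; have [adm hsep csep] := cond w w0.
  apply: (scaled_kernel graph_sunflower adjacency _ _ fE) => [i ih u|c].
    by apply: (hub_kernel graph_sunflower adm _ hsep s01 ih) => j jh; apply: thetaE.
  by rewrite scale0r addr0.
have wp2 (w : \bar R) (tau : R) : (0 <= w)%E -> 0 <= tau <= 1 ->
    well_posed loop A (freq P w) 1 tau.
  move=> w0 t01 f fE; have [adm hsep csep] := cond w w0.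
  have thetaw i : i \in hubs loop -> forall q, q \in petals_at loop i ->
      theta i w = \sum_(k in loop_vertices loop q) xi k w by move=> ih; apply: thetaE.
  apply: (scaled_kernel graph_sunflower adjacency _ _ fE) => [i ih u|c].
    by apply: (hub_kernel graph_sunflower adm thetaw hsep _ ih); rewrite ler01 lexx.
  exact: (central_kernel graph_sunflower adm thetaw hsep csep t01).
apply: (network_stable_pencil d_hurwitz Pfrac n_size).
  exact: (pencil_hurwitz graph_sunflower adjacency d_hurwitz Pfrac n_size wp1 wp2).
rewrite -(scaled_adjacency1 loop A).
apply: (pencil_size d_hurwitz Pfrac n_size); apply: wp2; first exact: leey.
by rewrite ler01 lexx.
Qed.
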